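(* For each of the following two statements $T$, the system $\mathsf{RCA}_0^\omega$ proves $T\to\mathsf{NIN}$, where $\mathsf{NIN}$ is the statement: for any $Y:[0,1]\to\mathbb{N}$ there are $x,y\in[0,1]$ with $x\neq_{\mathbb{R}}y$ and $Y(x)=Y(y)$. (1) Let $f$ and $(f_n)_{n\in\mathbb{N}}$ be Riemann integrable functions on $[0,1]$ such that $\lim_{n\to\infty}f_n(x)=f(x)$ for all $x\in[0,1]$. If there is $M\in\mathbb{N}$ such that $|f_n(x)|\le M+1$ for all $n\in\mathbb{N}$ and $x\in[0,1]$, then the limit $\lim_{n\to\infty}\int_0^1 f_n(x)\,dx$ exists. (2) ($\mathsf{Arz}^-$) Let $f$ and $(f_n)_{n\in\mathbb{N}}$ be Riemann integrable functions on $[0,1]$ such that $\lim_{n\to\infty}f_n(x)=f(x)$ for all $x\in[0,1]$. If there is $M\in\mathbb{N}$ such that $|f_n(x)|\le M+1$ for all $n\in\mathbb{N}$ and $x\in[0,1]$, then the sequence $\lambda n.\int_0^1 f_n(x)\,dx$ is metastable.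
   Context: A sequence of reals $(x_n)_{n\in\mathbb{N}}$ is metastable if $(\forall\varepsilon>0)(\forall g:\mathbb{N}\to\mathbb{N})(\exists N\in\mathbb{N})(\forall n,m\in[N,g(N)])(|x_n-x_m|<\varepsilon)$. Finite types: $0$ is a type (natural numbers), and if $\sigma,\tau$ are types then so is $\sigma\to\tau$; $1:=0\to 0$ and $n+1:=n\to 0$; superscripts indicate types. $\mathsf{L}_\omega$ is the many-sorted language with variables of every finite type, constants $0,1,<_0,+_0,\times_0,=_0$ (with usual meaning), typed combinators $\Pi,\Sigma$, and recursor constants $\mathbf{R}_\sigma$. For $\tau=(\tau_1\to\dots\to\tau_k\to 0)$, $x=_\tau y$ abbreviates $\forall z_1^{\tau_1}\dots z_k^{\tau_k}(xz_1\dots z_k=_0 yz_1\dots z_k)$. $\mathsf{QF\text{-}AC}^{\sigma,\tau}$ is the schema $(\forall x^\sigma)(\exists y^\tau)A(x,y)\to(\exists Y^{\sigma\to\tau})(\forall x^\sigma)A(x,Y(x))$ for quantifier-free $A$ of $\mathsf{L}_\omega$. $\mathsf{RCA}_0^\omega$ (Kohlenbach's base theory, classical logic) has the following axioms: ordered semi-ring axioms for $0,1,<_0,+_0,\times_0$; defining axioms of $\Pi,\Sigma$ (giving $\lambda$-abstraction); $\mathbf{R}_0(f,m,0)=m$ and $\mathbf{R}_0(f,m,n+1)=f(n,\mathbf{R}_0(f,m,n))$; extensionality $x=_\rho y\to\varphi(x)=_\tau\varphi(y)$ for all types $\rho,\tau$; induction for quantifier-free formulas of $\mathsf{L}_\omega$;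 and $\mathsf{QF\text{-}AC}^{1,0}$. Finite sequences are coded as usual. Inside this theory a real is a sequence of rationals $(q_n)$ with $|q_n-q_{n+i}|<2^{-n}$ for all $n,i$; reals $x,y$ represented by $(q_n),(r_n)$ satisfy $x=_{\mathbb{R}}y$ iff $|q_n-r_n|\le 2^{-n+1}$ for all $n$. Functions on $[0,1]$ or $\mathbb{R}$ with values in $\mathbb{N}$ or $\mathbb{R}$ are objects of the corresponding finite type that map $=_{\mathbb{R}}$-equal reals to equal values. Riemann integrability and the Riemann integral have their usual $\varepsilon$-$\delta$ definition (via Riemann sums over tagged partitions), for arbitrary third-order functions. *)

(* Defs.v *)
From Stdlib Require Import List.
Import ListNotations.

Inductive ty : Type :=
| T0 : ty
| Arr : ty -> ty -> ty.

Declare Scope ty_scope.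
Delimit Scope ty_scope with ty.
Bind Scope ty_scope with ty.
Notation "σ ⇒ τ" := (Arr σ τ) (at level 60, right associativity) : ty_scope.

Definition T1 : ty := (T0 ⇒ T0)%ty.
Definition T2 : ty := (T1 ⇒ T0)%ty.

(** Terms and formulas are well-typed by construction and live in a context
    listing the types of the (de Bruijn) free variables. *)
Definition ctx : Type := list ty.

Inductive var : ctx -> ty -> Type :=
| VZ {Γ σ} : var (σ :: Γ) σ
| VS {Γ σ τ} : var Γ τ -> var (σ :: Γ) τ.

Inductive const : ty -> Type :=
| cZero : const T0
| cOne : const T0
| cAdd : const (T0 ⇒ T0 ⇒ T0)
| cMul : const (T0 ⇒ T0 ⇒ T0)
| cPi (σ τ : ty) : const (σ ⇒ τ ⇒ σ)
| cSigma (ρ σ τ : ty) : const ((ρ ⇒ σ ⇒ τ) ⇒ (ρ ⇒ σ) ⇒ ρ ⇒ τ)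
| cRec (σ : ty) : const ((T0 ⇒ σ ⇒ σ) ⇒ σ ⇒ T0 ⇒ σ).

Inductive term (Γ : ctx) : ty -> Type :=
| Var {τ} : var Γ τ -> term Γ τ
| Cst {τ} : const τ -> term Γ τ
| App {σ τ} : term Γ (σ ⇒ τ) -> term Γ σ -> term Γ τ.
Arguments Var {Γ τ} _.
Arguments Cst {Γ τ} _.
Arguments App {Γ σ τ} _ _.

Inductive form (Γ : ctx) : Type :=
| fEq : term Γ T0 -> term Γ T0 -> form Γ
| fLt : term Γ T0 -> term Γ T0 -> form Γ
| fBot : form Γ
| fImp : form Γ -> form Γ -> form Γ
| fAll (σ : ty) : form (σ :: Γ) -> form Γ.
Arguments fEq {Γ} _ _.
Arguments fLt {Γ} _ _.
Arguments fBot {Γ}.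
Arguments fImp {Γ} _ _.
Arguments fAll {Γ} σ _.

Fixpoint quantifier_free {Γ} (A : form Γ) : Prop :=
  match A with
  | fEq _ _ | fLt _ _ | fBot => True
  | fImp B C => quantifier_free B /\ quantifier_free C
  | fAll _ _ => False
  end.

Definition sub (Γ Δ : ctx) : Type := forall τ, var Γ τ -> term Δ τ.

Fixpoint tsubst {Γ Δ} (s : sub Γ Δ) {τ} (t : term Γ τ) : term Δ τ :=
  match t with
  | Var v => s _ v
  | Cst c => Cst c
  | App t u => App (tsubst s t) (tsubst s u)
  end.

Definition shift {Γ σ} : sub Γ (σ :: Γ) := fun _ v => Var (VS v).

Definition scons {Γ Δ σ} (t : term Δ σ) (s : sub Γ Δ) : sub (σ :: Γ) Δ :=
  fun τ v =>
    match v in var (σ' :: Γ') τ' return term Δ σ' -> sub Γ' Δ -> term Δ τ' with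
    | VZ => fun t _ => t
    | VS v => fun _ s => s _ v
    end t s.

Definition up {Γ Δ σ} (s : sub Γ Δ) : sub (σ :: Γ) (σ :: Δ) :=
  scons (Var VZ) (fun _ v => tsubst shift (s _ v)).

Fixpoint fsubst {Γ Δ} (s : sub Γ Δ) (A : form Γ) : form Δ :=
  match A with
  | fEq t u => fEq (tsubst s t) (tsubst s u)
  | fLt t u => fLt (tsubst s t) (tsubst s u)
  | fBot => fBot
  | fImp B C => fImp (fsubst s B) (fsubst s C)
  | fAll σ B => fAll σ (fsubst (up s) B)
  end.

Definition inst {Γ σ} (t : term Γ σ) : sub (σ :: Γ) Γ :=
  scons t (fun _ v => Var v).

(** Inside the scope of a binder, [↑ t] transports a term from an outer context
    to the current one; the number of binders crossed is inferred. *)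

Class Incl (Γ Δ : ctx) : Type := incl : forall τ, var Γ τ -> var Δ τ.
#[export] Hint Mode Incl + + : typeclass_instances.
#[export] Instance incl_refl {Γ} : Incl Γ Γ | 0 := fun _ v => v.
#[export] Instance incl_step {Γ Δ σ} (i : Incl Γ Δ) : Incl Γ (σ :: Δ) | 1 :=
  fun _ v => VS (i _ v).

Definition wk {Γ Δ} {i : Incl Γ Δ} {τ} (t : term Γ τ) : term Δ τ :=
  tsubst (fun _ v => Var (i _ v)) t.

(** L_ω has no λ: [lam] is bracket abstraction with Π and Σ. *)
Fixpoint lam {Γ σ τ} (t : term (σ :: Γ) τ) : term Γ (σ ⇒ τ) :=
  match t in term _ τ return term Γ (σ ⇒ τ) with
  | @Var _ τ v =>
      match v in var (σ' :: Γ') τ' return term Γ' (σ' ⇒ τ') with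
      | @VZ _ ρ =>
          App (App (Cst (cSigma ρ (ρ ⇒ ρ) ρ)) (Cst (cPi ρ (ρ ⇒ ρ))))
              (Cst (cPi ρ ρ))
      | VS v => App (Cst (cPi _ _)) (Var v)
      end
  | Cst c => App (Cst (cPi _ _)) (Cst c)
  | App t u => App (App (Cst (cSigma _ _ _)) (lam t)) (lam u)
  end.

Definition bLam {Γ} (σ : ty) {τ} (b : term (σ :: Γ) σ -> term (σ :: Γ) τ)
  : term Γ (σ ⇒ τ) := lam (b (Var VZ)).
Definition bAll {Γ} (σ : ty) (b : term (σ :: Γ) σ -> form (σ :: Γ)) : form Γ :=
  fAll σ (b (Var VZ)).

Definition fNot {Γ} (A : form Γ) : form Γ := fImp A fBot.
Definition fAnd {Γ} (A B : form Γ) : form Γ := fNot (fImp A (fNot B)).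
Definition fOr {Γ} (A B : form Γ) : form Γ := fImp (fNot A) B.
Definition bEx {Γ} (σ : ty) (b : term (σ :: Γ) σ -> form (σ :: Γ)) : form Γ :=
  fNot (bAll σ (fun x => fNot (b x))).

Declare Scope tm_scope.
Delimit Scope tm_scope with tm.
Bind Scope tm_scope with term.
Declare Scope fm_scope.
Delimit Scope fm_scope with fm.
Bind Scope fm_scope with form.

Notation "↑ t" := (wk t) (at level 9, t at level 9, format "↑ t") : tm_scope.
Notation "t · u" := (App t u) (at level 11, left associativity) : tm_scope.
Notation "0" := (Cst cZero) : tm_scope.
Notation "1" := (Cst cOne) : tm_scope.
Notation "t + u" := (App (App (Cst cAdd) t) u) : tm_scope.
Notation "t * u" := (App (App (Cst cMul) t) u) : tm_scope.
Notation "λ[ x : σ ] t" := (bLam σ (fun x => t))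
  (at level 200, x name, t at level 200) : tm_scope.

Notation "t ≐ u" := (fEq t u) (at level 70, no associativity) : fm_scope.
Notation "t ≺ u" := (fLt t u) (at level 70, no associativity) : fm_scope.
Notation "t ≼ u" := (fOr (fLt t u) (fEq t u))
  (at level 70, no associativity) : fm_scope.
Notation "¬ A" := (fNot A) (at level 75, right associativity) : fm_scope.
Notation "A ∧ B" := (fAnd A B) (at level 80, right associativity) : fm_scope.
Notation "A ∨ B" := (fOr A B) (at level 85, right associativity) : fm_scope.
Notation "A ⟶ B" := (fImp A B) (at level 99, right associativity) : fm_scope.
Notation "∀[ x : σ ] A" := (bAll σ (fun x => A%fm))
  (at level 200, x name, A at level 200) : fm_scope.
Notation "∃[ x : σ ] A" := (bEx σ (fun x => A%fm))
  (at level 200, x name, A at level 200) : fm_scope.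

Local Open Scope fm_scope.
Local Open Scope tm_scope.

Fixpoint eqT {Γ} (τ : ty) : term Γ τ -> term Γ τ -> form Γ :=
  match τ return term Γ τ -> term Γ τ -> form Γ with
  | T0 => fun x y => x ≐ y
  | Arr σ τ => fun x y => ∀[z : σ] eqT τ (↑x · z) (↑y · z)
  end.

(** The schemas are stated for formulas with arbitrary parameters, namely the
    variables of [Γ]. *)
Inductive RCA0w {Γ : ctx} : form Γ -> Prop :=
| ax_addA : RCA0w (∀[x : T0] ∀[y : T0] ∀[z : T0] (↑x + ↑y) + z ≐ ↑x + (↑y + z))
| ax_addC : RCA0w (∀[x : T0] ∀[y : T0] ↑x + y ≐ y + ↑x)
| ax_add0 : RCA0w (∀[x : T0] x + 0 ≐ x)
| ax_mulA : RCA0w (∀[x : T0] ∀[y : T0] ∀[z : T0] (↑x * ↑y) * z ≐ ↑x * (↑y * z))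
| ax_mulC : RCA0w (∀[x : T0] ∀[y : T0] ↑x * y ≐ y * ↑x)
| ax_mul1 : RCA0w (∀[x : T0] x * 1 ≐ x)
| ax_mul0 : RCA0w (∀[x : T0] x * 0 ≐ 0)
| ax_mulD : RCA0w (∀[x : T0] ∀[y : T0] ∀[z : T0]
                     ↑x * (↑y + z) ≐ ↑x * ↑y + ↑x * z)
| ax_lt_irr : RCA0w (∀[x : T0] ¬ (x ≺ x))
| ax_lt_trans : RCA0w (∀[x : T0] ∀[y : T0] ∀[z : T0]
                         ↑x ≺ ↑y ⟶ ↑y ≺ z ⟶ ↑x ≺ z)
| ax_lt_total : RCA0w (∀[x : T0] ∀[y : T0] ↑x ≺ y ∨ ↑x ≐ y ∨ y ≺ ↑x)
| ax_lt_add : RCA0w (∀[x : T0] ∀[y : T0] ∀[z : T0]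
                       ↑x ≺ ↑y ⟶ ↑x + z ≺ ↑y + z)
| ax_lt_mul : RCA0w (∀[x : T0] ∀[y : T0] ∀[z : T0]
                       0 ≺ z ⟶ ↑x ≺ ↑y ⟶ ↑x * z ≺ ↑y * z)
| ax_lt01 : RCA0w (0 ≺ 1)
| ax_Pi (σ τ : ty) :
    RCA0w (∀[x : σ] ∀[y : τ] eqT σ (Cst (cPi σ τ) · ↑x · y) ↑x)
| ax_Sigma (ρ σ τ : ty) :
    RCA0w (∀[x : ρ ⇒ σ ⇒ τ] ∀[y : ρ ⇒ σ] ∀[z : ρ]
             eqT τ (Cst (cSigma ρ σ τ) · ↑x · ↑y · z) (↑x · z · (↑y · z)))
| ax_Rec_zero :
    RCA0w (∀[f : T0 ⇒ T0 ⇒ T0] ∀[m : T0] Cst (cRec T0) · ↑f · m · 0 ≐ m)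
| ax_Rec_succ :
    RCA0w (∀[f : T0 ⇒ T0 ⇒ T0] ∀[m : T0] ∀[n : T0]
             Cst (cRec T0) · ↑f · ↑m · (n + 1)
             ≐ ↑f · n · (Cst (cRec T0) · ↑f · ↑m · n))
| ax_ext (ρ τ : ty) :
    RCA0w (∀[x : ρ] ∀[y : ρ] ∀[φ : ρ ⇒ τ]
             eqT ρ ↑x ↑y ⟶ eqT τ (φ · ↑x) (φ · ↑y))
| ax_ind (A : form (T0 :: Γ)) :
    quantifier_free A ->
    RCA0w (fsubst (inst 0) A ⟶
           fAll T0 (A ⟶ fsubst (scons (Var VZ + 1) shift) A) ⟶
           fAll T0 A)
  (* QF-AC^{1,0}; in [A] the innermost variable is the number y, the next one
     the function x. *)
| ax_QFAC (A : form (T0 :: T1 :: Γ)) :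
    quantifier_free A ->
    RCA0w ((∀[x : T1] ¬ fAll T0 (¬ A)) ⟶
           ∃[Y : T2] ∀[x : T1]
             fsubst (scons (↑Y · x) (scons x (fun _ v => ↑(Var v)))) A).

(** [derives H A]: natural deduction with open hypotheses [H]. Every sort has a
    closed term, so tracking the free variables in [Γ] loses no theorem. *)
Inductive derives : forall {Γ : ctx}, list (form Γ) -> form Γ -> Prop :=
| d_hyp {Γ} (H : list (form Γ)) A : In A H -> derives H A
| d_ax {Γ} (H : list (form Γ)) A : RCA0w A -> derives H A
| d_imp_intro {Γ} (H : list (form Γ)) A B :
    derives (A :: H) B -> derives H (A ⟶ B)
| d_imp_elim {Γ} (H : list (form Γ)) A B :
    derives H (A ⟶ B) -> derives H A -> derives H B
| d_dne {Γ} (H : list (form Γ)) A : derives H (¬ ¬ A) -> derives H A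
| d_all_intro {Γ} (H : list (form Γ)) σ (A : form (σ :: Γ)) :
    derives (map (fsubst shift) H) A -> derives H (fAll σ A)
| d_all_elim {Γ} (H : list (form Γ)) σ (A : form (σ :: Γ)) (t : term Γ σ) :
    derives H (fAll σ A) -> derives H (fsubst (inst t) A)
| d_eq_refl {Γ} (H : list (form Γ)) (t : term Γ T0) : derives H (t ≐ t)
| d_eq_subst {Γ} (H : list (form Γ)) (A : form (T0 :: Γ)) (t u : term Γ T0) :
    derives H (t ≐ u) -> derives H (fsubst (inst t) A) ->
    derives H (fsubst (inst u) A).

Definition RCA0w_proves (A : form []) : Prop := derives [] A.

Definition nrec {Γ} (s : term Γ (T0 ⇒ T0 ⇒ T0)) (t u : term Γ T0) : term Γ T0 :=
  Cst (cRec T0) · s · t · u.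
Definition npred {Γ} (u : term Γ T0) : term Γ T0 :=
  nrec (λ[m : T0] λ[r : T0] ↑m) 0 u.
Definition nsub {Γ} (t u : term Γ T0) : term Γ T0 :=
  nrec (λ[m : T0] λ[r : T0] npred r) t u.
Definition npow2 {Γ} (u : term Γ T0) : term Γ T0 :=
  nrec (λ[m : T0] λ[r : T0] r + r) 1 u.
Notation "t ∸ u" := (nsub t u) (at level 50, left associativity) : tm_scope.

(** Cantor pairing; [ntroot u] is the largest [r] with [ntri r <= u]. *)
Definition ntri {Γ} (u : term Γ T0) : term Γ T0 :=
  nrec (λ[m : T0] λ[r : T0] r + (↑m + 1)) 0 u.
Definition ntroot {Γ} (u : term Γ T0) : term Γ T0 :=
  nrec (λ[m : T0] λ[r : T0] r + (1 ∸ (ntri (r + 1) ∸ (↑m + 1)))) 0 u.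
Definition npair {Γ} (t u : term Γ T0) : term Γ T0 := ntri (t + u) + u.
Definition nsnd {Γ} (u : term Γ T0) : term Γ T0 := u ∸ ntri (ntroot u).
Definition nfst {Γ} (u : term Γ T0) : term Γ T0 := ntroot u ∸ nsnd u.

(** [rat a b d] codes (a - b) / (d + 1); every number is the code of some
    rational. *)
Definition rat {Γ} (a b d : term Γ T0) : term Γ T0 := npair (npair a b) d.
Definition qpos {Γ} (q : term Γ T0) : term Γ T0 := nfst (nfst q).
Definition qneg {Γ} (q : term Γ T0) : term Γ T0 := nsnd (nfst q).
Definition qden {Γ} (q : term Γ T0) : term Γ T0 := nsnd q + 1.

Definition qlt {Γ} (q r : term Γ T0) : form Γ :=
  qpos q * qden r + qneg r * qden q ≺ qpos r * qden q + qneg q * qden r.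
Definition qle {Γ} (q r : term Γ T0) : form Γ :=
  qpos q * qden r + qneg r * qden q ≼ qpos r * qden q + qneg q * qden r.

Definition qadd {Γ} (q r : term Γ T0) : term Γ T0 :=
  rat (qpos q * qden r + qpos r * qden q) (qneg q * qden r + qneg r * qden q)
      (npred (qden q * qden r)).
Definition qopp {Γ} (q : term Γ T0) : term Γ T0 := rat (qneg q) (qpos q) (nsnd q).
Definition qmul {Γ} (q r : term Γ T0) : term Γ T0 :=
  rat (qpos q * qpos r + qneg q * qneg r) (qpos q * qneg r + qneg q * qpos r)
      (npred (qden q * qden r)).
Definition qanum {Γ} (q : term Γ T0) : term Γ T0 :=
  (qpos q ∸ qneg q) + (qneg q ∸ qpos q).
Definition qabs {Γ} (q : term Γ T0) : term Γ T0 := rat (qanum q) 0 (nsnd q).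
Definition qdist {Γ} (q r : term Γ T0) : term Γ T0 := qabs (qadd q (qopp r)).

(** 2^{-n} and 2^{-n+1} *)
Definition qexp {Γ} (n : term Γ T0) : term Γ T0 := rat 1 0 (npred (npow2 n)).
Definition qexp' {Γ} (n : term Γ T0) : term Γ T0 := rat (1 + 1) 0 (npred (npow2 n)).

Definition isreal {Γ} (x : term Γ T1) : form Γ :=
  ∀[n : T0] ∀[i : T0] qlt (qdist (↑x · ↑n) (↑x · (↑n + i))) (qexp ↑n).

Definition req {Γ} (x y : term Γ T1) : form Γ :=
  ∀[n : T0] qle (qdist (↑x · n) (↑y · n)) (qexp' n).
Definition rlt {Γ} (x y : term Γ T1) : form Γ :=
  ∃[n : T0] qlt (qadd (↑x · n) (qexp' n)) (↑y · n).
Definition rle {Γ} (x y : term Γ T1) : form Γ := ¬ rlt y x.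

Definition rnat {Γ} (u : term Γ T0) : term Γ T1 := λ[n : T0] rat ↑u 0 0.

(** The shifts of the index in the next operations make the result converge
    fast enough to be a real again. *)
Definition radd {Γ} (x y : term Γ T1) : term Γ T1 :=
  λ[n : T0] qadd (↑x · (n + 1)) (↑y · (n + 1)).
Definition ropp {Γ} (x : term Γ T1) : term Γ T1 := λ[n : T0] qopp (↑x · n).
Definition rsub {Γ} (x y : term Γ T1) : term Γ T1 := radd x (ropp y).
Definition rabs {Γ} (x : term Γ T1) : term Γ T1 := λ[n : T0] qabs (↑x · n).
Definition rdist {Γ} (x y : term Γ T1) : term Γ T1 := rabs (rsub x y).

(** |x_m| < |x_0| + 1 for all m, so b below satisfies |x_m| + |y_k| < 2^b. *)
Definition rmul {Γ} (x y : term Γ T1) : term Γ T1 :=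
  let b := qanum (x · 0) + qanum (y · 0) + (1 + 1) in
  λ[n : T0] qmul (↑x · (n + ↑b)) (↑y · (n + ↑b)).

(** The sum of the reals [a 0], ..., [a (k - 1)]; since only the recursor of
    type 0 is available, the summation is done on rational approximations. *)
Definition rsum {Γ} (k : term Γ T0) (a : term Γ (T0 ⇒ T1)) : term Γ T1 :=
  λ[n : T0] nrec (λ[i : T0] λ[s : T0] qadd s (↑a · ↑i · (↑n + ↑k)))
                 (rat 0 0 0) ↑k.

Definition in01 {Γ} (x : term Γ T1) : form Γ :=
  isreal x ∧ rle (rnat 0) x ∧ rle x (rnat 1).

Definition posreal {Γ} (x : term Γ T1) : form Γ := isreal x ∧ rlt (rnat 0) x.

(** A function on [0,1] is an object acting on codes of reals; its values off
    [0,1] are irrelevant. *)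
Definition fun01_nat {Γ} (Y : term Γ T2) : form Γ :=
  ∀[x : T1] ∀[y : T1] in01 ↑x ⟶ in01 y ⟶ req ↑x y ⟶ ↑Y · ↑x ≐ ↑Y · y.

Definition fun01_real {Γ} (f : term Γ (T1 ⇒ T1)) : form Γ :=
  (∀[x : T1] in01 x ⟶ isreal (↑f · x)) ∧
  (∀[x : T1] ∀[y : T1]
     in01 ↑x ⟶ in01 y ⟶ req ↑x y ⟶ req (↑f · ↑x) (↑f · y)).

(** 0 = x_0 < x_1 < ... < x_k = 1 with tags t_i in [x_i, x_{i+1}] for i < k. *)
Definition tagged_partition {Γ} (k : term Γ T0) (x t : term Γ (T0 ⇒ T1)) : form Γ :=
  (∀[i : T0] i ≼ ↑k ⟶ in01 (↑x · i)) ∧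
  (∀[i : T0] i ≺ ↑k ⟶ in01 (↑t · i)) ∧
  req (x · 0) (rnat 0) ∧ req (x · k) (rnat 1) ∧
  (∀[i : T0] i ≺ ↑k ⟶
     rlt (↑x · i) (↑x · (i + 1)) ∧
     rle (↑x · i) (↑t · i) ∧ rle (↑t · i) (↑x · (i + 1))).

Definition mesh_lt {Γ} (k : term Γ T0) (x : term Γ (T0 ⇒ T1)) (d : term Γ T1)
  : form Γ :=
  ∀[i : T0] i ≺ ↑k ⟶ rlt (rsub (↑x · (i + 1)) (↑x · i)) ↑d.

Definition riemann_sum {Γ} (f : term Γ (T1 ⇒ T1)) (k : term Γ T0)
    (x t : term Γ (T0 ⇒ T1)) : term Γ T1 :=
  rsum k (λ[i : T0] rmul (↑f · (↑t · i)) (rsub (↑x · (i + 1)) (↑x · i))).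

Definition is_integral {Γ} (f : term Γ (T1 ⇒ T1)) (a : term Γ T1) : form Γ :=
  isreal a ∧
  ∀[e : T1] posreal e ⟶
    ∃[d : T1] posreal d ∧
      ∀[k : T0] ∀[x : T0 ⇒ T1] ∀[t : T0 ⇒ T1]
        tagged_partition ↑k ↑x t ⟶ mesh_lt ↑k ↑x ↑d ⟶
        rlt (rdist (riemann_sum ↑f ↑k ↑x t) ↑a) ↑e.

Definition integrable {Γ} (f : term Γ (T1 ⇒ T1)) : form Γ :=
  ∃[a : T1] is_integral ↑f a.

Definition NIN : form [] :=
  ∀[Y : T2] fun01_nat Y ⟶
    ∃[x : T1] ∃[y : T1]
      in01 ↑x ∧ in01 y ∧ ¬ req ↑x y ∧ ↑Y · ↑x ≐ ↑Y · y.

Definition pointwise_limit {Γ} (F : term Γ (T0 ⇒ T1 ⇒ T1)) (f : term Γ (T1 ⇒ T1))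
  : form Γ :=
  ∀[x : T1] in01 x ⟶
    ∀[e : T1] posreal e ⟶
      ∃[N : T0] ∀[n : T0] ↑N ≼ n ⟶ rlt (rdist (↑F · n · ↑x) (↑f · ↑x)) ↑e.

Definition uniformly_bounded {Γ} (F : term Γ (T0 ⇒ T1 ⇒ T1)) : form Γ :=
  ∃[M : T0] ∀[n : T0] ∀[x : T1]
    in01 x ⟶ rle (rabs (↑F · ↑n · x)) (rnat (↑M + 1)).

(** As RCA_0^ω need not provide the sequence of the integrals as an object, the
    value of each integral is referred to by its definition. *)
Definition integrals_converge {Γ} (F : term Γ (T0 ⇒ T1 ⇒ T1)) : form Γ :=
  ∃[l : T1] isreal l ∧
    ∀[e : T1] posreal e ⟶
      ∃[N : T0] ∀[n : T0] ↑N ≼ n ⟶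
        ∀[a : T1] is_integral (↑F · ↑n) a ⟶ rlt (rdist a ↑l) ↑e.

Definition integrals_metastable {Γ} (F : term Γ (T0 ⇒ T1 ⇒ T1)) : form Γ :=
  ∀[e : T1] posreal e ⟶
    ∀[g : T1] ∃[N : T0] ∀[n : T0] ∀[m : T0]
      ↑N ≼ ↑n ⟶ ↑n ≼ ↑g · ↑N ⟶ ↑N ≼ m ⟶ m ≼ ↑g · ↑N ⟶
      ∀[a : T1] ∀[b : T1]
        is_integral (↑F · ↑n) ↑a ⟶ is_integral (↑F · ↑m) b ⟶
        rlt (rdist ↑a b) ↑e.

Definition bounded_convergence
    (concl : forall {Γ}, term Γ (T0 ⇒ T1 ⇒ T1) -> form Γ) : form [] :=
  ∀[f : T1 ⇒ T1] ∀[F : T0 ⇒ T1 ⇒ T1]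
    fun01_real ↑f ⟶ (∀[n : T0] fun01_real (↑F · n)) ⟶
    integrable ↑f ⟶ (∀[n : T0] integrable (↑F · n)) ⟶
    pointwise_limit F ↑f ⟶
    uniformly_bounded F ⟶
    concl F.

Definition Arz_limit : form [] := bounded_convergence (@integrals_converge).
Definition Arz_minus : form [] := bounded_convergence (@integrals_metastable).

(* Main.v *)
From Stdlib Require Import List Eqdep_dec Cantor.
From HB Require Import structures.
From mathcomp Require Import all_boot all_order all_algebra generic_quotient.
From mathcomp Require Import boolp ring lra.
Import Order.TTheory GRing.Theory Num.Theory.
Require Import Defs.

Set Implicit Arguments.
Unset Strict Implicit.
Unset Printing Implicit Defensive.

(** Suppose Y : [0,1] -> N is injective and let F_n be 0 for even n and the
    indicator of {Y > n} for odd n. Then F_n tends to 0 pointwise, while the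
    integral of F_n is 0 for even n and 1 for odd n: by injectivity a tagged
    partition has at most three tags at which Y takes a given value, so the tags
    with Y <= n contribute at most 3(n+1) times the mesh to a Riemann sum of F_n.
    Hence the integrals neither converge nor are metastable.

    This argument is carried out in an arbitrary model of RCA_0^omega, and
    derivability follows from Gödel's completeness theorem, proved by Henkin's
    construction. In a model, the numbers of type 0 generate an ordered field
    that contains the values of all codes of rationals; sums over k terms, k
    possibly nonstandard, are estimated there by quantifier-free induction. *)

(** * Substitution *)

(** The order of the reals is not quantifier-free, while a partition may have nonstandard length
    [k]. Hence no induction along a partition can speak about reals: its hypothesis has to compare
    rational approximations at one fixed index [p]. Each step then costs a multiple of [eps p], and
    k steps cost a multiple of [k * eps p]. This stays small because [rsum] reads its summands at an
    index beyond [k]. Counting is restricted in the same way: the number of tags with a small value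
    of Y is itself a recursively defined number of the model, bounded by induction on the threshold.

    In the completeness proof the language consists of well-typed terms over a context, and each
    Henkin witness is a new variable. The contexts therefore change from stage to stage, and the
    limit language is described by sequences that are eventually transported by [shift]. The
    extensionality axiom lets the term model be divided by hereditary equality, after which the
    equality of every type is genuine equality. *)

Lemma ty_eq_dec (σ τ : ty) : {σ = τ} + {σ <> τ}.
Proof. decide equality. Qed.

Lemma var_ind_cons Γ σ (P : forall τ, var (σ :: Γ) τ -> Prop) :
  P σ VZ -> (forall τ v, P τ (VS v)) -> forall τ v, P τ v.
Proof.
move=> P0 PS τ v.
refine (match v as v' in var (σ' :: Γ') τ'
  return forall Q : forall τ, var (σ' :: Γ') τ -> Prop,
    Q σ' VZ -> (forall τ v, Q τ (VS v)) -> Q τ' v' with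
  | VZ _ _ => fun Q Q0 QS => Q0 | VS _ _ _ v => fun Q Q0 QS => QS _ v end P P0 PS).
Qed.

Lemma var_nil τ (v : var nil τ) : False.
Proof. by inversion v. Qed.

Lemma sub_ext Γ Δ (s r : sub Γ Δ) : (forall τ v, s τ v = r τ v) -> s = r.
Proof.
by move=> e; apply: functional_extensionality_dep => τ; apply: funext => v.
Qed.

Lemma tsubst_comp Γ Δ Θ (r : sub Δ Θ) (s : sub Γ Δ) τ (t : term Γ τ) :
  tsubst r (tsubst s t) = tsubst (fun τ v => tsubst r (s τ v)) t.
Proof. by elim: t => //= σ' τ' t -> u ->. Qed.

Lemma tsubst_id Γ τ (t : term Γ τ) : tsubst (fun _ v => Var v) t = t.
Proof. by elim: t => //= σ' τ' t -> u ->. Qed.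

Lemma up_comp Γ Δ Θ (r : sub Δ Θ) (s : sub Γ Δ) σ :
  (fun τ v => tsubst (up r) (up (σ := σ) s τ v)) = up (fun τ v => tsubst r (s τ v)).
Proof.
by apply: sub_ext => τ; move: τ; apply: var_ind_cons => //= τ v; rewrite !tsubst_comp.
Qed.

Lemma fsubst_comp Γ Δ Θ (r : sub Δ Θ) (s : sub Γ Δ) (A : form Γ) :
  fsubst r (fsubst s A) = fsubst (fun τ v => tsubst r (s τ v)) A.
Proof.
elim: A Δ Θ r s => //= {Γ} [Γ t u|Γ t u|Γ A IA B IB|Γ σ A IA] Δ Θ r s.
- by rewrite !tsubst_comp.
- by rewrite !tsubst_comp.
- by rewrite IA IB.
- by rewrite IA up_comp.
Qed.

Lemma up_id Γ σ : up (fun τ (v : var Γ τ) => Var v) = fun τ (v : var (σ :: Γ) τ) => Var v.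
Proof. by apply: sub_ext => τ; move: τ; apply: var_ind_cons. Qed.

Lemma fsubst_id Γ (A : form Γ) : fsubst (fun _ v => Var v) A = A.
Proof.
elim: A => //= {Γ} [Γ t u|Γ t u|Γ A IA B IB|Γ σ A IA].
- by rewrite !tsubst_id.
- by rewrite !tsubst_id.
- by rewrite IA IB.
- by rewrite up_id IA.
Qed.

Lemma tsubst_inst_shift Γ σ (t : term Γ σ) τ (u : term Γ τ) :
  tsubst (inst t) (tsubst shift u) = u.
Proof. by rewrite tsubst_comp /= tsubst_id. Qed.

Lemma wk_shift Γ σ τ (u : term Γ τ) : @wk Γ (σ :: Γ) _ τ u = tsubst shift u.
Proof. by []. Qed.

Lemma tsubst_up_shift Γ Δ σ (s : sub Γ Δ) τ (u : term Γ τ) :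
  tsubst (up (σ := σ) s) (tsubst shift u) = tsubst shift (tsubst s u).
Proof. by rewrite !tsubst_comp. Qed.

Lemma fsubst_eqT Γ Δ (s : sub Γ Δ) τ (x y : term Γ τ) :
  fsubst s (eqT τ x y) = eqT τ (tsubst s x) (tsubst s y).
Proof.
elim: τ Γ Δ s x y => //= σ _ τ IH Γ Δ s x y.
by rewrite /bAll /= IH /= !wk_shift !tsubst_up_shift.
Qed.

Lemma fsubst_inst_up Γ Δ (s : sub Γ Δ) σ (A : form (σ :: Γ)) (t : term Γ σ) :
  fsubst (inst (tsubst s t)) (fsubst (up s) A) = fsubst s (fsubst (inst t) A).
Proof.
rewrite !fsubst_comp; congr fsubst; apply: sub_ext => τ; move: τ.
by apply: var_ind_cons => //= τ v; rewrite tsubst_inst_shift.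
Qed.

Lemma quantifier_free_fsubst Γ Δ (s : sub Γ Δ) (A : form Γ) :
  quantifier_free A -> quantifier_free (fsubst s A).
Proof.
elim: A Δ s => //= {Γ} Γ A IA B IB Δ s [qA qB].
by split; [apply: IA|apply: IB].
Qed.

(** The axioms are stated over every context, and the term model evaluates them under a substitution
    into the context of a stage; the result must again be an axiom. For induction and choice, the
    substitution has to be moved past the ones inside the schema. *)
Lemma RCA0w_fsubst Γ Δ (s : sub Γ Δ) A : RCA0w A -> RCA0w (fsubst s A).
Proof.
case=> {A}.
- exact: ax_addA.
- exact: ax_addC.
- exact: ax_add0.
- exact: ax_mulA.
- exact: ax_mulC.
- exact: ax_mul1.
- exact: ax_mul0.
- exact: ax_mulD.
- exact: ax_lt_irr.
- exact: ax_lt_trans.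
- exact: ax_lt_total.
- exact: ax_lt_add.
- exact: ax_lt_mul.
- exact: ax_lt01.
- move=> σ τ; have := @ax_Pi Δ σ τ.
  by rewrite /bAll /= fsubst_eqT.
- move=> ρ σ τ; have := @ax_Sigma Δ ρ σ τ.
  by rewrite /bAll /= fsubst_eqT.
- exact: ax_Rec_zero.
- exact: ax_Rec_succ.
- move=> ρ τ; have := @ax_ext Δ ρ τ.
  by rewrite /bAll /= !fsubst_eqT.
- move=> A qA.
  have := ax_ind _ (quantifier_free_fsubst (up s) qA).
  rewrite /= -(fsubst_inst_up s A (Cst cZero)) /=.
  congr (RCA0w (fImp _ (fImp (fAll _ (fImp _ _)) _))).
  rewrite !fsubst_comp; congr fsubst; apply: sub_ext => τ; move: τ.
  by apply: var_ind_cons => //= τ v; rewrite tsubst_comp.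
- move=> A qA.
  have := ax_QFAC _ (quantifier_free_fsubst (up (up s)) qA).
  rewrite /bEx /bAll /=; congr RCA0w.
  rewrite /fNot /=; do 7 f_equal.
  rewrite !fsubst_comp; congr fsubst; apply: sub_ext => τ; move: τ.
  apply: var_ind_cons => //= τ; move: τ; apply: var_ind_cons => //= τ v.
  rewrite !tsubst_comp /=.
  by congr tsubst; apply: sub_ext => ρ w /=; rewrite !tsubst_comp.
Qed.

(** * Structures and countability of the language *)

(** Extensionality is built in as [app_ext], so that [eqT] is interpreted by plain equality at every
    type ([sat_eqT]). *)
Record structure := Structure {
  dom :> ty -> Type;
  app : forall σ τ, dom (Arr σ τ) -> dom σ -> dom τ;
  cst : forall τ, const τ -> dom τ;
  mlt : dom T0 -> dom T0 -> Prop;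
  app_ext : forall σ τ (f g : dom (Arr σ τ)),
    (forall x, app f x = app g x) -> f = g }.

Definition env (M : structure) (Γ : ctx) := forall τ, var Γ τ -> M τ.

Definition econs (M : structure) Γ σ (x : M σ) (ρ : env M Γ) : env M (σ :: Γ) :=
  fun τ v =>
    match v in var (σ' :: Γ') τ' return M σ' -> env M Γ' -> M τ' with
    | VZ _ _ => fun x _ => x
    | VS _ _ _ v => fun _ ρ => ρ _ v
    end x ρ.

Definition enil (M : structure) : env M nil :=
  fun τ v => match v in var Γ _ return (if Γ is nil then M τ else unit) with
             | VZ _ _ => tt | VS _ _ _ _ => tt end.

Fixpoint eval (M : structure) Γ (ρ : env M Γ) τ (t : term Γ τ) : M τ :=
  match t with
  | Var _ v => ρ _ v
  | Cst _ c => cst M c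
  | App _ _ t u => app (eval ρ t) (eval ρ u)
  end.

Fixpoint sat (M : structure) Γ (ρ : env M Γ) (A : form Γ) : Prop :=
  match A with
  | fEq t u => eval ρ t = eval ρ u
  | fLt t u => mlt (eval ρ t) (eval ρ u)
  | fBot => False
  | fImp A B => sat ρ A -> sat ρ B
  | fAll σ A => forall x : M σ, sat (econs x ρ) A
  end.

Definition is_model (M : structure) :=
  forall Γ (ρ : env M Γ) (A : form Γ), RCA0w A -> sat ρ A.

Fixpoint ty_code (τ : ty) : GenTree.tree nat :=
  match τ with
  | T0 => GenTree.Leaf 0
  | Arr σ τ => GenTree.Node 0 [:: ty_code σ; ty_code τ]
  end.

Lemma ty_code_inj : injective ty_code.
Proof. by elim=> [|σ IHσ τ IHτ] [|σ' τ'] //= [/IHσ-> /IHτ->]. Qed.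

Fixpoint var_code Γ τ (v : var Γ τ) : nat :=
  match v with VZ _ _ => 0 | VS _ _ _ v => (var_code v).+1 end.

Lemma existT_ty_inj (P : ty -> Type) τ (x y : P τ) :
  existT P τ x = existT P τ y -> x = y.
Proof. exact: (inj_pair2_eq_dec _ ty_eq_dec). Qed.
Arguments existT_ty_inj {P τ x y}.

(** In a fixed context the index of a variable determines its type as well, whence an equality of
    dependent pairs. *)
Lemma var_code_inj Γ σ (v : var Γ σ) τ (w : var Γ τ) :
  var_code v = var_code w -> existT (var Γ) σ v = existT (var Γ) τ w.
Proof.
elim: v τ w => {Γ σ} [Γ σ|Γ σ τ v IH]; apply: var_ind_cons => //= ρ w [] /IH e.
exact: (congr1 (fun p => existT (var _) (projT1 p) (VS (projT2 p))) e).
Qed.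

Definition const_code τ (c : const τ) : GenTree.tree nat :=
  match c with
  | cZero => GenTree.Leaf 0
  | cOne => GenTree.Leaf 1
  | cAdd => GenTree.Leaf 2
  | cMul => GenTree.Leaf 3
  | cPi σ τ => GenTree.Node 0 [:: ty_code σ; ty_code τ]
  | cSigma ρ σ τ => GenTree.Node 1 [:: ty_code ρ; ty_code σ; ty_code τ]
  | cRec σ => GenTree.Node 2 [:: ty_code σ]
  end.

Lemma const_code_inj σ (c : const σ) τ (d : const τ) :
  const_code c = const_code d -> existT const σ c = existT const τ d.
Proof.
case: c; case: d => //=.
- by move=> ???? [] /ty_code_inj-> /ty_code_inj->.
- by move=> ?????? [] /ty_code_inj-> /ty_code_inj-> /ty_code_inj->.
- by move=> ?? [] /ty_code_inj->.
Qed.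

(** The argument type σ is recorded because the type of an application does not determine it. *)
Fixpoint term_code Γ τ (t : term Γ τ) : GenTree.tree nat :=
  match t with
  | Var _ v => GenTree.Leaf (var_code v)
  | Cst _ c => GenTree.Node 0 [:: const_code c]
  | App σ _ t u => GenTree.Node 1 [:: ty_code σ; term_code t; term_code u]
  end.

Lemma term_code_inj Γ τ (t u : term Γ τ) : term_code t = term_code u -> t = u.
Proof.
elim: t u => {τ} [τ v|τ c|σ τ t IHt t' IHt'] u.
- case: u v => //= {}τ w v [] /var_code_inj; by move/existT_ty_inj->.
- by case: u c => //= {}τ d c [] /const_code_inj/existT_ty_inj->.
- by case: u t IHt => //= σ' {}τ u u' t IHt [] /ty_code_inj e; subst σ' => /IHt-> /IHt'->.
Qed.

Fixpoint form_code Γ (A : form Γ) : GenTree.tree nat :=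
  match A with
  | fEq t u => GenTree.Node 0 [:: term_code t; term_code u]
  | fLt t u => GenTree.Node 1 [:: term_code t; term_code u]
  | fBot => GenTree.Leaf 0
  | fImp A B => GenTree.Node 2 [:: form_code A; form_code B]
  | fAll σ A => GenTree.Node 3 [:: ty_code σ; form_code A]
  end.

Lemma form_code_inj Γ : injective (@form_code Γ).
Proof.
elim=> {Γ} [Γ t u|Γ t u|Γ|Γ A IA B IB|Γ σ A IA] [t' u'|t' u'||A' B'|σ' A'] //=.
- by case=> /term_code_inj-> /term_code_inj->.
- by case=> /term_code_inj-> /term_code_inj->.
- by case=> /IA-> /IB->.
- by case=> /ty_code_inj e; subst σ' => /IA->.
Qed.

Lemma form_countable Γ : exists e : nat -> form Γ, forall A, exists n, e n = A.
Proof.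
have [e eP] : {e : nat -> form Γ &
    forall n A, pickle (form_code A) = n -> e n = A}.
  apply: (@choice _ _ (fun n B => forall A, pickle (form_code A) = n -> B = A)) => n.
  have [[A nA]|nA] := pselect (exists A : form Γ, pickle (form_code A) = n).
    exists A => B nB; apply: form_code_inj.
    exact: (pcan_inj pickleK (etrans nA (esym nB))).
  by exists fBot => B nB; case: nA; exists B.
by exists e => A; exists (pickle (form_code A)); apply: eP.
Qed.

Definition form_enum Γ : nat -> form Γ := projT1 (cid (form_countable Γ)).

Lemma form_enumP Γ (A : form Γ) : exists n, form_enum Γ n = A.
Proof. exact: projT2 (cid (form_countable Γ)) A. Qed.

(** * Completeness *)

Definition consistent Γ (H : list (form Γ)) := ~ derives H fBot.

Fixpoint closed_term Γ (τ : ty) : term Γ τ :=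
  match τ with
  | T0 => Cst cZero
  | Arr σ τ => App (Cst (cPi τ σ)) (closed_term Γ τ)
  end.

(** Every type has a closed term; put for the fresh variable, it turns a contradiction in the larger
    context into one in the smaller. *)
Lemma consistent_shift Γ (H : list (form Γ)) σ :
  consistent H -> consistent (List.map (fsubst (@shift Γ σ)) H).
Proof.
move=> cH dH; apply: cH.
exact: (d_all_elim _ _ _ (closed_term Γ σ) (d_all_intro _ _ _ dH)).
Qed.

(* A stage records the formulas accepted so far and, for each [k], an
   enumeration of the formulas of stage [k] transported to the present one. *)
Record stage := Stage {
  scx : ctx;
  hyps : list (form scx);
  pending : nat -> nat -> form scx }.

Definition wit_ty Γ (A : form Γ) : ty :=
  match A with fAll σ _ => σ | _ => T0 end.

(** The Henkin axiom for a refused formula. For [fAll σ B] the variable added to the context is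
    itself the counterexample to [B]; for other formulas a tautology keeps all stages of the same
    shape. *)
Definition wit_form Γ (A : form Γ) : form (wit_ty A :: Γ) :=
  match A with fAll σ B => fNot B | _ => fNot fBot end.

Definition next_stage (n : nat) (S : stage) (A : form (scx S)) : stage :=
  @Stage (wit_ty A :: scx S)
    (if pselect (consistent (A :: hyps S))
     then List.map (fsubst shift) (A :: hyps S)
     else wit_form A :: List.map (fsubst shift) (fNot A :: hyps S))
    (* The row of the new stage starts as a fresh enumeration in the enlarged context; older rows
       are only transported. *)
    (fun k j => if k == n.+1 then form_enum _ j
                else fsubst shift (pending S k j)).

Lemma hyps_next_consistent n S (A : form (scx S)) : consistent (A :: hyps S) ->
  hyps (next_stage n A) = List.map (fsubst shift) (A :: hyps S).
Proof. by rewrite /next_stage /=; case: pselect. Qed.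

Lemma hyps_next_inconsistent n S (A : form (scx S)) : ~ consistent (A :: hyps S) ->
  hyps (next_stage n A) = wit_form A :: List.map (fsubst shift) (fNot A :: hyps S).
Proof. by rewrite /next_stage /=; case: pselect. Qed.

Lemma In_next_stage n S (A B : form (scx S)) :
  In B (hyps S) -> In (fsubst shift B) (hyps (next_stage n A)).
Proof.
move=> inB; have [c|c] := pselect (consistent (A :: hyps S)).
  by rewrite hyps_next_consistent//; apply: List.in_map; right.
by rewrite hyps_next_inconsistent//; right; apply: List.in_map; right.
Qed.

Lemma trivial_wit Γ (H : list (form Γ)) σ : consistent H ->
  ~ derives (fNot fBot :: List.map (fsubst (@shift Γ σ)) H) fBot.
Proof.
move=> cH d; apply: (consistent_shift (σ := σ) cH).
apply: (d_imp_elim _ _ _ (d_imp_intro _ _ _ d)).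
by apply: d_imp_intro; apply: d_hyp; left.
Qed.

(** A refused formula has a derivable negation, so adding that is harmless. As for the witness, a
    contradiction from [fNot B] at the fresh variable would prove [B] generically, hence [fAll σ B],
    against its recorded negation. *)
Lemma consistent_next n S A : consistent (hyps S) ->
  consistent (hyps (@next_stage n S A)).
Proof.
move=> cS; have [cA|cA] := pselect (consistent (A :: hyps S)).
  rewrite hyps_next_consistent//.
  exact: (consistent_shift (σ := wit_ty A) cA).
rewrite hyps_next_inconsistent//; have {cA} dA : derives (hyps S) (fNot A).
  by apply: d_imp_intro; apply: contrapT.
have cnA : consistent (fNot A :: hyps S).
  by move=> d; apply: cS; apply: d_imp_elim dA; apply: d_imp_intro.
case: A dA cnA => /= [t u|t u||A B|σ A] _ cnA dw;
  [exact: trivial_wit cnA dw..|].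
have nA : derives (fNot (fAll σ A) :: hyps S) (fNot (fAll σ A)).
  by apply: d_hyp; left.
apply: cnA; apply: (d_imp_elim _ _ _ nA).
by apply: d_all_intro; apply: d_dne; apply: d_imp_intro.
Qed.

(** [B] is the request as the chain computes it and [A] the formula it turns out to be. The context
    of the next stage depends on [B], so the equation is a premise instead of being rewritten
    there. *)
Lemma next_stage_or n S (A B : form (scx S)) : B = A ->
  In (fsubst (@shift _ (wit_ty B)) A) (hyps (next_stage n B)) \/
  In (fsubst (@shift _ (wit_ty B)) (fNot A)) (hyps (next_stage n B)).
Proof.
move=> ->; have [c|c] := pselect (consistent (A :: hyps S)).
  by left; rewrite hyps_next_consistent//; left.
by right; rewrite hyps_next_inconsistent//; right; left.
Qed.

Lemma next_stage_all n S σ (A : form (σ :: scx S)) (B : form (scx S)) :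
  B = fAll σ A ->
  In (fsubst (@shift _ (wit_ty B)) (fAll σ A)) (hyps (next_stage n B)) \/
  exists t : term (scx (next_stage n B)) σ,
    In (fNot (fsubst (inst t) (fsubst (up (@shift _ (wit_ty B))) A)))
       (hyps (next_stage n B)).
Proof.
move=> ->; have [c|c] := pselect (consistent (fAll σ A :: hyps S)).
  by left; rewrite hyps_next_consistent//; left.
right; exists (Var VZ); rewrite hyps_next_inconsistent//; left.
rewrite fsubst_comp /= /fNot; congr fImp.
rewrite -[LHS]fsubst_id; congr fsubst; apply: sub_ext => τ; move: τ.
exact: var_ind_cons.
Qed.

Lemma derives_sym Γ (H : list (form Γ)) t u :
  derives H (fEq t u) -> derives H (fEq u t).
Proof.
move=> tu; have := d_eq_subst _ (fEq (Var VZ) (tsubst shift t)) t u tu.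
by rewrite /= !tsubst_inst_shift; apply; apply: d_eq_refl.
Qed.

Lemma derives_trans Γ (H : list (form Γ)) t u v :
  derives H (fEq t u) -> derives H (fEq u v) -> derives H (fEq t v).
Proof.
move=> tu uv; have := d_eq_subst _ (fEq (tsubst shift t) (Var VZ)) u v uv.
by rewrite /= !tsubst_inst_shift; apply.
Qed.

Lemma derives_lt Γ (H : list (form Γ)) t t' u u' :
  derives H (fEq t t') -> derives H (fEq u u') ->
  derives H (fLt t u) -> derives H (fLt t' u').
Proof.
move=> tt' uu' tu.
have := d_eq_subst _ (fLt (tsubst shift t') (Var VZ)) u u' uu'.
rewrite /= !tsubst_inst_shift; apply.
have := d_eq_subst _ (fLt (Var VZ) (tsubst shift u)) t t' tt'.
by rewrite /= !tsubst_inst_shift; apply.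
Qed.

Lemma derives_ext Γ (H : list (form Γ)) σ τ (x y : term Γ σ) (f : term Γ (Arr σ τ)) :
  derives H (eqT σ x y) -> derives H (eqT τ (App f x) (App f y)).
Proof.
move=> xy; apply: d_imp_elim xy.
have h1 := d_all_elim _ _ _ x (d_ax H _ (ax_ext σ τ)).
rewrite /bAll /= !fsubst_eqT /= in h1.
have h2 := d_all_elim _ _ _ y h1; rewrite /= !fsubst_eqT /= in h2.
have h3 := d_all_elim _ _ _ f h2; rewrite /= !fsubst_eqT /= in h3.
by move: h3; rewrite tsubst_up_shift !tsubst_inst_shift.
Qed.

(** * The Henkin chain and its term model *)

Section Completeness.
Variable A0 : form nil.
Hypothesis A0_underivable : ~ derives nil A0.

Fixpoint chain (n : nat) : stage :=
  match n with
  | 0 => @Stage nil [:: fNot A0] (fun _ j => form_enum _ j)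
  | n.+1 => @next_stage n (chain n)
              (let (k, j) := Cantor.of_nat n in pending (chain n) k j)
  end.

Definition request n := let (k, j) := Cantor.of_nat n in pending (chain n) k j.

Notation G n := (scx (chain n)).
Notation H n := (hyps (chain n)).

Lemma consistent_chain n : consistent (H n).
Proof.
elim: n => [|n IH]; last exact: consistent_next.
by move=> d; apply: A0_underivable; apply: d_dne; apply: d_imp_intro.
Qed.

Definition evt (P : nat -> Prop) := exists N, forall n, N <= n -> P n.

Lemma evt_all (P : nat -> Prop) : (forall n, P n) -> evt P.
Proof. by move=> h; exists 0. Qed.

Lemma evt_imp (P Q : nat -> Prop) :
  evt (fun n => P n -> Q n) -> evt P -> evt Q.
Proof.
move=> [N hN] [N' hN']; exists (maxn N N') => n; rewrite geq_max => /andP[le le'].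
exact: hN (hN' _ le').
Qed.

Lemma evt_impl (P Q : nat -> Prop) : (forall n, P n -> Q n) -> evt P -> evt Q.
Proof. by move=> h; apply: evt_imp; apply: evt_all. Qed.

Lemma evt_impl2 (P Q R : nat -> Prop) :
  (forall n, P n -> Q n -> R n) -> evt P -> evt Q -> evt R.
Proof. by move=> h eP; apply: evt_imp; apply: evt_impl eP. Qed.

Lemma evt_ex (P : nat -> Prop) : evt P -> exists n, P n.
Proof. by case=> N hN; exists N; apply: hN. Qed.

(** A context is finite, so the thresholds of its variables have a common bound. *)
Lemma evt_var Γ (P : forall τ, var Γ τ -> nat -> Prop) :
  (forall τ v, evt (P τ v)) -> evt (fun n => forall τ v, P τ v n).
Proof.
elim: Γ P => [|σ Γ IH] P h; first by apply: evt_all => n τ v; case: (var_nil v).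
apply: evt_impl2 (h _ VZ) (IH (fun τ v => P τ (VS v)) _) => [n P0 PS|τ v]; last exact: h.
by apply: var_ind_cons.
Qed.

(** Coherent sequences play the part of the terms and formulas of the limit language; only their
    behaviour from some stage on matters. *)
Definition coht τ (u : forall n, term (G n) τ) :=
  evt (fun n => u n.+1 = tsubst shift (u n)).
Definition cohf (a : forall n, form (G n)) :=
  evt (fun n => a n.+1 = fsubst shift (a n)).

Definition tru (a : forall n, form (G n)) := evt (fun n => In (a n) (H n)).

Lemma In_next n (A : form (G n)) : In A (H n) -> In (fsubst shift A) (H n.+1).
Proof. exact: In_next_stage. Qed.

Lemma tru_at (a : forall n, form (G n)) n : (forall m, n <= m -> a m.+1 = fsubst shift (a m)) ->
  In (a n) (H n) -> tru a.
Proof.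
move=> ca an; exists n => m /subnK<-; elim: (m - n) => [//|k IH].
change (In (a (k + n).+1) (H (k + n).+1)).
by rewrite ca ?leq_addl//; apply: In_next.
Qed.

Lemma pending_chain N j n : N <= n ->
  pending (chain n.+1) N j = fsubst shift (pending (chain n) N j).
Proof. by move=> le; rewrite /= ltn_eqF. Qed.

Lemma pending_self N j : pending (chain N) N j = form_enum (G N) j.
Proof. by case: N => //= N; rewrite eqxx. Qed.

(** Once [a] is coherent, at N say, [a N] has an index j in the enumeration of stage N. The Cantor
    code of (N, j) is at least N, so when that request is served the row entry has been transported
    along with [a]. The bound [N0] lets [tru_all] wait until the body of a quantifier is coherent
    too. *)
Lemma cohf_processed (a : forall n, form (G n)) N0 : cohf a -> exists n, [/\ N0 <= n,
  (forall m, n <= m -> a m.+1 = fsubst shift (a m)) &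
  request n = a n].
Proof.
move=> [N1 ca1].
have [N [le0 ca]] : exists N, N0 <= N /\
    forall m, N <= m -> a m.+1 = fsubst shift (a m).
  exists (maxn N0 N1); split=> [|m le]; first exact: leq_maxl.
  by apply: ca1; apply: leq_trans le; apply: leq_maxr.
have [j ej] := form_enumP (a N).
have pa n : N <= n -> pending (chain n) N j = a n.
  move=> /subnK<-; elim: (n - N) => [|k IH]; first by rewrite pending_self.
  change (pending (chain (k + N).+1) N j = a (k + N).+1).
  by rewrite ca ?leq_addl// pending_chain ?leq_addl// IH.
have leN : N <= Cantor.to_nat (N, j).
  have /ssrnat.leP := Cantor.to_nat_non_decreasing N j.
  by apply: leq_trans; rewrite leq_addl.
exists (Cantor.to_nat (N, j)); split=> [|m le|].
- exact: leq_trans leN.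
- by apply: ca; apply: leq_trans le.
- by rewrite /request -(pa _ leN) Cantor.cancel_of_to.
Qed.

Lemma tru_or a : cohf a -> tru a \/ tru (fun n => fNot (a n)).
Proof.
move=> /(cohf_processed 0)[n [_ ca en]].
case: (next_stage_or n en) => an; [left|right].
  by apply: (@tru_at _ n.+1) => [m /ltnW /ca//|]; rewrite ca.
by apply: (@tru_at _ n.+1) => [m /ltnW /ca->//|]; rewrite ca.
Qed.

Lemma tru_derives a : cohf a -> evt (fun n => derives (H n) (a n)) -> tru a.
Proof.
move=> /tru_or[//|na] da.
have /evt_ex[n /consistent_chain//] : evt (fun n => derives (H n) fBot).
by apply: evt_impl2 na da => n na; apply: d_imp_elim; apply: d_hyp.
Qed.

Lemma derives_tru a : tru a -> evt (fun n => derives (H n) (a n)).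
Proof. by apply: evt_impl => n; apply: d_hyp. Qed.

Lemma tru_bot : ~ tru (fun n => fBot).
Proof.
by move/derives_tru/evt_ex => [n /consistent_chain].
Qed.

Lemma tru_contra a : tru a -> tru (fun n => fNot (a n)) -> False.
Proof.
move=> ta na; have /evt_ex[n /consistent_chain//] : evt (fun n => derives (H n) fBot).
apply: evt_impl2 na ta => n na ta; apply: (d_imp_elim _ (a n)); exact: d_hyp.
Qed.

Lemma tru_imp a b : cohf a -> cohf b ->
  tru (fun n => fImp (a n) (b n)) <-> (tru a -> tru b).
Proof.
move=> ca cb; split.
  move=> /derives_tru dab /derives_tru da; apply: tru_derives => //.
  by apply: evt_impl2 dab da => n; apply: d_imp_elim.
move=> ab; apply: tru_derives; first by apply: evt_impl2 ca cb => n -> ->.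
have [/ab|] := tru_or ca; apply: evt_impl => n inH; apply: d_imp_intro.
  by apply: d_hyp; right.
apply: d_dne; apply: d_imp_intro; apply: (d_imp_elim _ (a n)); apply: d_hyp.
  by right; right.
by right; left.
Qed.

Record fam τ := Fam { fam_val :> forall n, term (G n) τ; fam_coh : coht fam_val }.

Lemma fam_at N τ (t : term (G N) τ) : exists u : fam τ,
  u N = t /\ forall n, N <= n -> u n.+1 = tsubst shift (u n).
Proof.
have [u [uN cu]] : exists u : forall n, term (G n) τ,
    u N = t /\ forall n, N <= n -> u n.+1 = tsubst shift (u n).
  (* Below N the values are dummies, at N the term is [t] up to a cast, and beyond N it is
     shifted. *)
  pose u := fix u n : term (G n) τ :=
    match PeanoNat.Nat.eq_dec N n with
    | left e => eq_rect N (fun n => term (G n) τ) t n e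
    | right _ => match n with
                 | 0 => closed_term nil τ
                 | n.+1 => tsubst shift (u n)
                 end
    end.
  exists u; split=> [|n le].
    rewrite /u; case: (N) (t) => [|k] s /=; first by [].
    by case: PeanoNat.Nat.eq_dec => //= e; rewrite (UIP_dec PeanoNat.Nat.eq_dec e erefl).
  rewrite [LHS]/=; case: PeanoNat.Nat.eq_dec => //= e.
  by exfalso; move: le; rewrite e ltnn.
by exists (@Fam _ u (ex_intro _ N cu)).
Qed.

Definition cohb σ (B : forall n, form (σ :: G n)) :=
  evt (fun n => B n.+1 = fsubst (up shift) (B n)).

Lemma cohb_inst σ (B : forall n, form (σ :: G n)) (u : fam σ) : cohb B ->
  cohf (fun n => fsubst (inst (u n)) (B n)).
Proof.
move=> cB; apply: evt_impl2 cB (fam_coh u) => n -> ->.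
by rewrite fsubst_inst_up.
Qed.

(** From right to left this is the Henkin property: had the universal formula been refused when it
    was served, its negated instance at the witness would be in the chain, and the witness extends
    to a family by [fam_at]. *)
Lemma tru_all σ (B : forall n, form (σ :: G n)) : cohb B ->
  tru (fun n => fAll σ (B n)) <->
  forall u : fam σ, tru (fun n => fsubst (inst (u n)) (B n)).
Proof.
move=> cB; have cA : cohf (fun n => fAll σ (B n)) by apply: evt_impl cB => n ->.
split=> [/derives_tru dB u|BP].
  apply: tru_derives; first exact: cohb_inst.
  by apply: evt_impl dB => n dB; apply: d_all_elim.
have [N cBN] := cB.
have [n [leN ca en]] := cohf_processed N cA.
have [inB|[t int]] := next_stage_all n en.
  by apply: (@tru_at _ n.+1) => [m /ltnW /ca//|]; rewrite ca.
have [u [un cu]] := @fam_at n.+1 σ t.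
case: (@tru_contra (fun m => fsubst (inst (u m)) (B m))); first exact: BP.
apply: (@tru_at _ n.+1) => [m lem|]; last first.
  by rewrite un cBN.
by rewrite cBN ?(leq_trans leN (ltnW lem))// cu// fsubst_inst_up.
Qed.

Definition fapp σ τ (u : fam (Arr σ τ)) (v : fam σ) : fam τ.
Proof.
exists (fun n => App (u n) (v n)).
abstract by apply: evt_impl2 (fam_coh u) (fam_coh v) => n -> ->.
Defined.

(* The term model is a quotient by this hereditary equality, which makes it
   extensional; [tru_eqT] relates it to the equality of the language. *)
Fixpoint feq τ : fam τ -> fam τ -> Prop :=
  match τ with
  | T0 => fun u v => tru (fun n => fEq (u n) (v n))
  | Arr σ τ => fun u v => forall w : fam σ, feq (fapp u w) (fapp v w)
  end.

Lemma feq_refl τ (u : fam τ) : feq u u.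
Proof.
elim: τ u => [u|σ _ τ IH u w]; last exact: IH.
apply: tru_derives; last by apply: evt_all => n; apply: d_eq_refl.
by apply: evt_impl (fam_coh u) => n ->.
Qed.

Lemma feq_sym τ (u v : fam τ) : feq u v -> feq v u.
Proof.
elim: τ u v => [u v /derives_tru uv|σ _ τ IH u v uv w]; last exact: IH.
apply: tru_derives; last by apply: evt_impl uv => n; apply: derives_sym.
by apply: evt_impl2 (fam_coh u) (fam_coh v) => n -> ->.
Qed.

Lemma feq_trans τ (u v w : fam τ) : feq u v -> feq v w -> feq u w.
Proof.
elim: τ u v w => [u v w /derives_tru uv /derives_tru vw|σ _ τ IH u v w uv vw x];
  last exact: IH (uv x) (vw x).
apply: tru_derives; last by apply: evt_impl2 uv vw => n; apply: derives_trans.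
by apply: evt_impl2 (fam_coh u) (fam_coh w) => n -> ->.
Qed.

Lemma tru_eqT τ (u v : fam τ) : tru (fun n => eqT τ (u n) (v n)) <-> feq u v.
Proof.
elim: τ u v => [//|σ _ τ IH] u v.
have cB : cohb (fun n => eqT τ (App (tsubst (@shift _ σ) (u n)) (Var VZ))
                           (App (tsubst shift (v n)) (Var VZ))).
  apply: evt_impl2 (fam_coh u) (fam_coh v) => n -> ->.
  by rewrite fsubst_eqT /= !tsubst_up_shift.
rewrite [X in X <-> _](tru_all cB) /=.
split=> h w; first apply/IH; [|have /IH := h w].
  by have := h w; apply: evt_impl => n; rewrite fsubst_eqT /= !tsubst_inst_shift.
by apply: evt_impl => n; rewrite fsubst_eqT /= !tsubst_inst_shift.
Qed.

Lemma coh_eqT τ (u v : fam τ) : cohf (fun n => eqT τ (u n) (v n)).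
Proof.
by apply: evt_impl2 (fam_coh u) (fam_coh v) => n -> ->; rewrite fsubst_eqT.
Qed.

(** Here the extensionality axiom enters, through [derives_ext]; it makes application well defined
    on the quotient. *)
Lemma feq_app σ τ (u : fam (Arr σ τ)) (v w : fam σ) :
  feq v w -> feq (fapp u v) (fapp u w).
Proof.
move=> /tru_eqT/derives_tru vw; apply/tru_eqT; apply: tru_derives; first exact: coh_eqT.
by apply: evt_impl vw => n; apply: derives_ext.
Qed.

Lemma tru_lt (u u' v v' : fam T0) : feq u u' -> feq v v' ->
  tru (fun n => fLt (u n) (v n)) -> tru (fun n => fLt (u' n) (v' n)).
Proof.
move=> /derives_tru uu /derives_tru vv /derives_tru uv; apply: tru_derives.
  by apply: evt_impl2 (fam_coh u') (fam_coh v') => n -> ->.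
by apply: evt_imp uv; apply: evt_impl2 uu vv => n; apply: derives_lt.
Qed.

Lemma fam_ext τ (u v : fam τ) : (forall n, u n = v n) -> u = v.
Proof.
case: u v => [u cu] [v cv] /= uv.
have e : u = v by apply: functional_extensionality_dep.
by subst v; rewrite (Prop_irrelevance cu cv).
Qed.

Definition cls_of τ := {P : fam τ -> Prop | exists u, P = feq u}.
Definition cls τ (u : fam τ) : cls_of τ := exist _ (feq u) (ex_intro _ u erefl).

Lemma clsP τ (x : cls_of τ) : exists u, x = cls u.
Proof. by case: x => P [u eP]; exists u; subst P. Qed.

Definition rep τ (x : cls_of τ) : fam τ := projT1 (cid (clsP x)).

Lemma repK τ (x : cls_of τ) : cls (rep x) = x.
Proof. exact: esym (projT2 (cid (clsP x))). Qed.

Lemma cls_eq τ (u v : fam τ) : cls u = cls v <-> feq u v.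
Proof.
split=> [[e]|uv]; first by rewrite e; apply: feq_refl.
apply: eq_exist => /=; apply: funext => w; apply: propext.
by split; apply: feq_trans => //; apply: feq_sym.
Qed.

Lemma feq_rep τ (u : fam τ) : feq (rep (cls u)) u.
Proof. by apply/cls_eq; rewrite repK. Qed.

Definition fcst τ (c : const τ) : fam τ :=
  @Fam _ (fun n => Cst c) (evt_all (fun n => erefl)).

(** At an arrow type, hereditary equality is by definition agreement on all arguments, so the
    quotient is extensional. *)
Lemma term_app_ext σ τ (f g : cls_of (Arr σ τ)) :
  (forall x : cls_of σ, cls (fapp (rep f) (rep x)) = cls (fapp (rep g) (rep x))) -> f = g.
Proof.
move=> fg; rewrite -(repK f) -(repK g); apply/cls_eq => w.
have /cls_eq fgw := fg (cls w).
have e (h : fam (Arr σ τ)) : feq (fapp h w) (fapp h (rep (cls w))).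
  by apply/feq_app/feq_sym/feq_rep.
exact: (feq_trans (e (rep f)) (feq_trans fgw (feq_sym (e (rep g))))).
Qed.

Definition term_model : structure :=
  @Structure cls_of (fun _ _ f x => cls (fapp (rep f) (rep x)))
    (fun _ c => cls (fcst c)) (fun x y => tru (fun n => fLt (rep x n) (rep y n)))
    term_app_ext.

Lemma app_cls σ τ (u : fam (Arr σ τ)) (v : fam σ) :
  @app term_model _ _ (cls u) (cls v) = cls (fapp u v).
Proof.
apply/cls_eq; apply: feq_trans (feq_app u (feq_rep v)).
exact: (feq_rep u (rep (cls v))).
Qed.

Definition fenv Γ := forall τ, var Γ τ -> fam τ.
Definition sub_at Γ (ρ : fenv Γ) n : sub Γ (G n) := fun τ v => ρ τ v n.

Lemma sub_atS Γ (ρ : fenv Γ) :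
  evt (fun n => sub_at ρ n.+1 = fun τ v => tsubst shift (sub_at ρ n v)).
Proof.
have : evt (fun n => forall τ v, ρ τ v n.+1 = tsubst shift (ρ τ v n)).
  by apply: evt_var => τ v; apply: fam_coh.
by apply: evt_impl => n h; apply: sub_ext.
Qed.

Definition fterm Γ (ρ : fenv Γ) τ (t : term Γ τ) : fam τ.
Proof.
exists (fun n => tsubst (sub_at ρ n) t).
abstract by apply: evt_impl (sub_atS ρ) => n ->; rewrite tsubst_comp.
Defined.

Lemma cohf_sub Γ (ρ : fenv Γ) A : cohf (fun n => fsubst (sub_at ρ n) A).
Proof. by apply: evt_impl (sub_atS ρ) => n ->; rewrite fsubst_comp. Qed.

Lemma cohb_sub Γ (ρ : fenv Γ) σ (A : form (σ :: Γ)) :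
  cohb (fun n => fsubst (up (sub_at ρ n)) A).
Proof. by apply: evt_impl (sub_atS ρ) => n ->; rewrite fsubst_comp up_comp. Qed.

Definition cls_env Γ (ρ : fenv Γ) : env term_model Γ := fun τ v => cls (ρ τ v).

Lemma eval_cls Γ (ρ : fenv Γ) τ (t : term Γ τ) :
  eval (cls_env ρ) t = cls (fterm ρ t).
Proof.
elim: t => [σ v|σ c|σ σ' t IHt u IHu].
- by rewrite /= /cls_env; congr cls; apply: fam_ext.
- by rewrite /=; congr cls; apply: fam_ext.
- rewrite [LHS]/= IHt IHu [LHS]app_cls; congr cls; exact: fam_ext.
Qed.

(** The truth lemma. Its implication case rests on the chain deciding every formula, its quantifier
    case on the witnesses. *)
Lemma sat_tru Γ (ρ : fenv Γ) A :
  sat (cls_env ρ) A <-> tru (fun n => fsubst (sub_at ρ n) A).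
Proof.
elim: A ρ => {Γ} [Γ t u|Γ t u|Γ|Γ A IA B IB|Γ σ A IA] ρ.
- by rewrite /= !eval_cls cls_eq.
- rewrite /= !eval_cls /=.
  have et := feq_rep (fterm ρ t); have eu := feq_rep (fterm ρ u).
  by split; [apply: tru_lt et eu|apply: tru_lt (feq_sym et) (feq_sym eu)].
- by split=> // /tru_bot.
- rewrite [X in _ <-> X](tru_imp (cohf_sub ρ A) (cohf_sub ρ B)) /=.
  by split=> AB /IA /AB /IB.
- rewrite [X in _ <-> X](tru_all (cohb_sub ρ A)) /=.
  have e (u : fam σ) : sat (econs (M := term_model) (cls u) (cls_env ρ)) A <->
      tru (fun n => fsubst (inst (u n)) (fsubst (up (sub_at ρ n)) A)).
    pose ρu : fenv (σ :: Γ) := fun τ v =>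
      match v in var (σ' :: Γ') τ' return fam σ' -> fenv Γ' -> fam τ' with
      | VZ _ _ => fun x _ => x | VS _ _ _ v => fun _ ρ => ρ _ v end u ρ.
    have -> : econs (M := term_model) (cls u) (cls_env ρ) = cls_env ρu.
      apply: functional_extensionality_dep => τ; apply: funext; move: τ.
      exact: var_ind_cons.
    rewrite IA; suff -> : (fun n => fsubst (sub_at ρu n) A) =
      (fun n => fsubst (inst (u n)) (fsubst (up (sub_at ρ n)) A)) by [].
    apply: functional_extensionality_dep => n.
    rewrite fsubst_comp; congr fsubst; apply: sub_ext => τ; move: τ.
    by apply: var_ind_cons => //= τ v; rewrite tsubst_inst_shift.
  split=> h x; first exact/e.
  by have [u ->] := clsP x; apply/e.
Qed.

Lemma env_cls Γ (ρ : env term_model Γ) : exists r : fenv Γ, ρ = cls_env r.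
Proof.
exists (fun τ v => rep (ρ τ v)).
apply: functional_extensionality_dep => τ; apply: funext => v.
exact: esym (repK _).
Qed.

Lemma term_model_axioms : is_model term_model.
Proof.
move=> Γ ρ A axA; have [r ->] := env_cls ρ.
apply/sat_tru/tru_derives; first exact: cohf_sub.
by apply: evt_all => n; apply: d_ax; apply: RCA0w_fsubst.
Qed.

Lemma term_model_refutes (ρ : env term_model nil) : ~ sat ρ A0.
Proof.
have [r ->] := env_cls ρ; move/sat_tru => tA.
apply: (tru_contra tA); have := cohf_sub r (fNot A0).
(* The chain starts with the negation of [A0], and a closed formula is the same at every stage
   whatever is substituted. *)
case=> N cN; exists 0 => n _; elim: n => [|n IH].
  left; rewrite /fNot /=; congr fImp; rewrite -[LHS]fsubst_id; congr fsubst.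
  by apply: sub_ext => τ v; case: (var_nil v).
have e : fsubst shift (fsubst (sub_at r n) A0) = fsubst (sub_at r n.+1) A0.
  by rewrite fsubst_comp; congr fsubst; apply: sub_ext => τ v; case: (var_nil v).
by have := In_next IH; rewrite [X in In X _]/= e.
Qed.

End Completeness.

Theorem completeness (A : form nil) :
  (forall M, is_model M -> sat (enil M) A) -> derives nil A.
Proof.
move=> h; apply: contrapT => nA.
exact: (@term_model_refutes _ nA _ (h _ (@term_model_axioms _ nA))).
Qed.

(** * The ordered field of fractions *)

(** What the numbers must satisfy to yield an ordered field. The differences of [nl_sub] provide
    both inverses and the normal form of nonnegative fractions. *)
Record natlike := Natlike {
  nl_sort :> comNzSemiRingType;
  nl_lt : nl_sort -> nl_sort -> Prop;
  nl_irr : forall x, ~ nl_lt x x;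
  nl_trans : forall x y z, nl_lt x y -> nl_lt y z -> nl_lt x z;
  nl_total : forall x y, [\/ nl_lt x y, x = y | nl_lt y x];
  nl_add : forall x y z, nl_lt x y -> nl_lt (x + z)%R (y + z)%R;
  nl_mul : forall x y z, nl_lt 0%R z -> nl_lt x y -> nl_lt (x * z)%R (y * z)%R;
  nl_succ_gt0 : forall x, nl_lt 0%R (x + 1)%R;
  nl_sub : forall x y, nl_lt x y -> exists z, y = (x + z + 1)%R }.

Section Fractions.
Variable N : natlike.
Implicit Types a b c d : N.
Local Open Scope ring_scope.
Local Open Scope quotient_scope.
Notation "x ≺ y" := (nl_lt x y) (at level 70).

Lemma nl_ltNge a b : a ≺ b -> ~ b ≺ a.
Proof. by move=> ab /(nl_trans ab) /nl_irr. Qed.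

Lemma nl_addI c a b : a + c = b + c -> a = b.
Proof. by case: (nl_total a b) => // /(nl_add c) + e; rewrite e => /nl_irr. Qed.

Lemma nl_mulI c a b : a * (c + 1) = b * (c + 1) -> a = b.
Proof.
by case: (nl_total a b) => // /(nl_mul (nl_succ_gt0 c)) + e; rewrite e => /nl_irr.
Qed.

(* [(a, b, d)] stands for [(a - b) / (d + 1)]. *)
Let pre := (N * N * N)%type.
Implicit Types r s t : pre.

Definition pre_eq r s :=
  r.1.1 * (s.2 + 1) + s.1.2 * (r.2 + 1) == s.1.1 * (r.2 + 1) + r.1.2 * (s.2 + 1).

Lemma pre_eq_refl : reflexive pre_eq.
Proof. by move=> r; apply/eqP; ring. Qed.

Lemma pre_eq_sym : symmetric pre_eq.
Proof. by move=> r s; rewrite /pre_eq eq_sym. Qed.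

Lemma pre_eq_trans : transitive pre_eq.
Proof.
move=> [[a' b'] d'] [[a b] d] [[a'' b''] d'']; rewrite /pre_eq /= => /eqP h1 /eqP h2.
(* In the absence of subtraction, the middle fraction is eliminated by multiplying by its
   denominator and adding its two numerators, suitably scaled, to both sides; both operations
   cancel. *)
apply/eqP; apply: (@nl_mulI d'); apply: (@nl_addI ((a' + b') * (d + 1) * (d'' + 1))).
transitivity ((a * (d' + 1) + b' * (d + 1)) * (d'' + 1) +
  (a' * (d'' + 1) + b'' * (d' + 1)) * (d + 1)); first by ring.
by rewrite h1 h2; ring.
Qed.

Canonical pre_equiv := EquivRel pre_eq pre_eq_refl pre_eq_sym pre_eq_trans.

Definition frac := {eq_quot pre_equiv}.
HB.instance Definition _ := Choice.on frac.

Definition mkfrac r : frac := \pi_frac r.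

Lemma mkfrac_eq r s : mkfrac r = mkfrac s <-> pre_eq r s.
Proof. by split=> [/eqmodP//|h]; apply/eqmodP. Qed.

Lemma pre_eq_repr r : pre_eq (repr (mkfrac r)) r.
Proof. by apply/mkfrac_eq; rewrite /mkfrac reprK. Qed.

Lemma fracP (x : frac) : exists r, x = mkfrac r.
Proof. by exists (repr x); rewrite /mkfrac reprK. Qed.

Definition pre_add r s : pre :=
  (r.1.1 * (s.2 + 1) + s.1.1 * (r.2 + 1), r.1.2 * (s.2 + 1) + s.1.2 * (r.2 + 1),
   r.2 * s.2 + r.2 + s.2).
Definition pre_opp r : pre := (r.1.2, r.1.1, r.2).
Definition pre_mul r s : pre :=
  (r.1.1 * s.1.1 + r.1.2 * s.1.2, r.1.1 * s.1.2 + r.1.2 * s.1.1,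
   r.2 * s.2 + r.2 + s.2).

Lemma pre_addC r s : pre_add r s = pre_add s r.
Proof. by rewrite /pre_add; congr (_, _, _); ring. Qed.

Lemma pre_mulC r s : pre_mul r s = pre_mul s r.
Proof. by rewrite /pre_mul; congr (_, _, _); ring. Qed.

Lemma pre_add_eq r r' s : pre_eq r r' -> pre_eq (pre_add r s) (pre_add r' s).
Proof.
case: r r' s => [[a b] d] [[a' b'] d'] [[a2 b2] d2] /eqP /= h; apply/eqP => /=.
transitivity ((a * (d' + 1) + b' * (d + 1)) * (d2 + 1) * (d2 + 1) +
  (a2 + b2) * (d + 1) * (d' + 1) * (d2 + 1)); first by ring.
by rewrite h; ring.
Qed.

Lemma pre_mul_eq r r' s : pre_eq r r' -> pre_eq (pre_mul r s) (pre_mul r' s).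
Proof.
case: r r' s => [[a b] d] [[a' b'] d'] [[a2 b2] d2] /eqP /= h; apply/eqP => /=.
transitivity ((a * (d' + 1) + b' * (d + 1)) * (d2 + 1) * a2 +
  (a' * (d + 1) + b * (d' + 1)) * (d2 + 1) * b2); first by ring.
by rewrite h -[in X in _ + X]h; ring.
Qed.

Lemma pre_opp_eq r r' : pre_eq r r' -> pre_eq (pre_opp r) (pre_opp r').
Proof.
case: r r' => [[a b] d] [[a' b'] d'] /eqP /= h; apply/eqP => /=.
by rewrite addrC -h addrC.
Qed.

Definition frac_add (x y : frac) : frac := mkfrac (pre_add (repr x) (repr y)).
Definition frac_opp (x : frac) : frac := mkfrac (pre_opp (repr x)).
Definition frac_mul (x y : frac) : frac := mkfrac (pre_mul (repr x) (repr y)).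

Lemma mkfrac_add r s : frac_add (mkfrac r) (mkfrac s) = mkfrac (pre_add r s).
Proof.
apply/mkfrac_eq; apply: (pre_eq_trans (pre_add_eq _ (pre_eq_repr r))).
by rewrite pre_addC [pre_add r s]pre_addC; apply: pre_add_eq; apply: pre_eq_repr.
Qed.

Lemma mkfrac_mul r s : frac_mul (mkfrac r) (mkfrac s) = mkfrac (pre_mul r s).
Proof.
apply/mkfrac_eq; apply: (pre_eq_trans (pre_mul_eq _ (pre_eq_repr r))).
by rewrite pre_mulC [pre_mul r s]pre_mulC; apply: pre_mul_eq; apply: pre_eq_repr.
Qed.

Lemma mkfrac_opp r : frac_opp (mkfrac r) = mkfrac (pre_opp r).
Proof. by apply/mkfrac_eq/pre_opp_eq/pre_eq_repr. Qed.

Definition frac0 := mkfrac (0, 0, 0).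
Definition frac1 := mkfrac (1, 0, 0).

Lemma frac_addA : associative frac_add.
Proof.
move=> x y z; have [r ->] := fracP x; have [s ->] := fracP y; have [t ->] := fracP z.
by rewrite !mkfrac_add; apply/mkfrac_eq/eqP; rewrite /pre_add /=; ring.
Qed.

Lemma frac_addC : commutative frac_add.
Proof. by move=> x y; rewrite /frac_add pre_addC. Qed.

Lemma frac_add0 : left_id frac0 frac_add.
Proof.
move=> x; have [r ->] := fracP x.
by rewrite !mkfrac_add; apply/mkfrac_eq/eqP; rewrite /pre_add /=; ring.
Qed.

Lemma frac_addN : left_inverse frac0 frac_opp frac_add.
Proof.
move=> x; have [r ->] := fracP x.
by rewrite mkfrac_opp !mkfrac_add; apply/mkfrac_eq/eqP; rewrite /pre_add /=; ring.
Qed.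

HB.instance Definition _ := GRing.isZmodule.Build frac
  frac_addA frac_addC frac_add0 frac_addN.

Lemma mkfracD r s : mkfrac r + mkfrac s = mkfrac (pre_add r s).
Proof. exact: mkfrac_add. Qed.

Lemma frac_mulA : associative frac_mul.
Proof.
move=> x y z; have [r ->] := fracP x; have [s ->] := fracP y; have [t ->] := fracP z.
by rewrite !mkfrac_mul; apply/mkfrac_eq/eqP; rewrite /pre_mul /=; ring.
Qed.

Lemma frac_mulC : commutative frac_mul.
Proof. by move=> x y; rewrite /frac_mul pre_mulC. Qed.

Lemma frac_mul1 : left_id frac1 frac_mul.
Proof.
move=> x; have [r ->] := fracP x.
by rewrite !mkfrac_mul; apply/mkfrac_eq/eqP; rewrite /pre_mul /=; ring.
Qed.

Lemma frac_mulDl : left_distributive frac_mul +%R.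
Proof.
move=> x y z; have [r ->] := fracP x; have [s ->] := fracP y; have [t ->] := fracP z.
rewrite mkfracD !mkfrac_mul mkfracD.
by apply/mkfrac_eq/eqP; rewrite /pre_mul /pre_add /=; ring.
Qed.

Lemma frac_1neq0 : frac1 != 0.
Proof.
apply/negP => /eqP/mkfrac_eq/eqP /=; rewrite !(add0r, addr0, mulr1, mul0r) => e.
by have := @nl_succ_gt0 N 0; rewrite add0r e => /nl_irr.
Qed.

HB.instance Definition _ := GRing.Zmodule_isComNzRing.Build frac
  frac_mulA frac_mulC frac_mul1 frac_mulDl frac_1neq0.

(** If a and b differ, the difference is z + 1 up to sign, and the reciprocal is (d + 1) / (z + 1)
    with that sign. The case of 0 is prescribed so that the chosen inverse obeys the convention for
    0. *)
Lemma frac_inv_ex (x : frac) : exists y, if x == 0 then y = 0 else y * x = 1.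
Proof.
case: eqP => [_|x0]; first by exists 0.
have [[[a b] d] e] := fracP x; rewrite e in x0 *.
case: (nl_total a b) x0 => [/nl_sub[z ->] _||/nl_sub[z ->] _].
- exists (mkfrac (0, d + 1, z)); rewrite [LHS]mkfrac_mul.
  by apply/mkfrac_eq/eqP => /=; ring.
- by move=> -> []; apply/mkfrac_eq/eqP => /=; ring.
- exists (mkfrac (d + 1, 0, z)); rewrite [LHS]mkfrac_mul.
  by apply/mkfrac_eq/eqP => /=; ring.
Qed.

Lemma mkfracM r s : mkfrac r * mkfrac s = mkfrac (pre_mul r s).
Proof. exact: mkfrac_mul. Qed.

Definition frac_inv (x : frac) : frac := projT1 (cid (frac_inv_ex x)).

Lemma frac_mulV (x : frac) : x != 0 -> frac_inv x * x = 1.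
Proof. by move=> /negbTE x0; rewrite /frac_inv; case: cid => y; rewrite x0. Qed.

Lemma frac_inv0 : frac_inv 0 = 0.
Proof. by rewrite /frac_inv; case: cid => y; rewrite eqxx. Qed.

HB.instance Definition _ := GRing.ComNzRing_isField.Build frac frac_mulV frac_inv0.

Definition frac_ge0 (x : frac) : bool := ~~ `[< (repr x).1.1 ≺ (repr x).1.2 >].

Lemma pre_lt_eq r s : pre_eq r s -> r.1.1 ≺ r.1.2 -> s.1.1 ≺ s.1.2.
Proof.
case: r s => [[a b] d] [[a' b'] d'] /eqP /= h ab.
have {}ab := nl_mul (nl_succ_gt0 d') ab.
case: (nl_total a' b') => [//|e|/(nl_mul (nl_succ_gt0 d)) ab'].
  by move: h ab; rewrite e [in RHS]addrC => /nl_addI -> /nl_irr.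
have := nl_add (b' * (d + 1)) ab; rewrite h [X in _ ≺ X]addrC => t.
by case: (nl_irr (nl_trans t (nl_add (b * (d' + 1)) ab'))).
Qed.

Lemma mkfrac_ge0 r : frac_ge0 (mkfrac r) = ~~ `[< r.1.1 ≺ r.1.2 >].
Proof.
congr (~~ _); apply/asboolP/asboolP; apply: pre_lt_eq.
  exact: pre_eq_repr.
by rewrite pre_eq_sym pre_eq_repr.
Qed.

Lemma mkfrac_ge0P r : reflect (~ r.1.1 ≺ r.1.2) (frac_ge0 (mkfrac r)).
Proof. by rewrite mkfrac_ge0; apply: (iffP negP) => h /asboolP. Qed.

Lemma nl_ge0 a : ~ a ≺ 0.
Proof. by move=> /nl_sub[z e]; have := nl_succ_gt0 (a + z); rewrite -e => /nl_irr. Qed.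

Lemma frac_ge0P (x : frac) : reflect (exists p d, x = mkfrac (p, 0, d)) (frac_ge0 x).
Proof.
apply: (iffP idP) => [|[p [d ->]]]; last by apply/mkfrac_ge0P/nl_ge0.
have [[[a b] d] ->] := fracP x => /mkfrac_ge0P /= ba.
case: (nl_total a b) => [//|->|/nl_sub[z ->]].
  by exists 0, d; apply/mkfrac_eq/eqP => /=; ring.
by exists (z + 1), d; apply/mkfrac_eq/eqP => /=; ring.
Qed.

Definition frac_le (x y : frac) := frac_ge0 (y - x).
Definition frac_norm (x : frac) := if frac_ge0 x then x else - x.

Lemma frac_le0 x : frac_le 0 x = frac_ge0 x.
Proof. by rewrite /frac_le subr0. Qed.

Lemma frac_le_add x y : frac_le 0 x -> frac_le 0 y -> frac_le 0 (x + y).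
Proof.
rewrite !frac_le0 => /frac_ge0P[p [d ->]] /frac_ge0P[p' [d' ->]]; rewrite mkfracD.
by apply/mkfrac_ge0P => /=; rewrite !mul0r addr0; apply: nl_ge0.
Qed.

Lemma frac_le_mul x y : frac_le 0 x -> frac_le 0 y -> frac_le 0 (x * y).
Proof.
rewrite !frac_le0 => /frac_ge0P[p [d ->]] /frac_ge0P[p' [d' ->]]; rewrite mkfracM.
by apply/mkfrac_ge0P => /=; rewrite !mulr0 !mul0r !addr0; apply: nl_ge0.
Qed.

Lemma frac_oppE r : - mkfrac r = mkfrac (pre_opp r).
Proof. exact: mkfrac_opp. Qed.

Lemma frac_le_anti x : frac_le 0 x -> frac_le x 0 -> x = 0.
Proof.
rewrite frac_le0 /frac_le sub0r => /frac_ge0P[p [d ->]].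
rewrite frac_oppE => /mkfrac_ge0P /= np.
case: (nl_total p 0) => [/nl_ge0//|->|//]; apply/mkfrac_eq/eqP => /=; ring.
Qed.

Lemma frac_sub_ge0 x y : frac_le 0 (y - x) = frac_le x y.
Proof. exact: frac_le0. Qed.

Lemma frac_ge0_or x : frac_ge0 x || frac_ge0 (- x).
Proof.
have [r ->] := fracP x; rewrite frac_oppE !mkfrac_ge0 -negb_and.
by apply/negP => /andP[/asboolP h /asboolP /nl_ltNge].
Qed.

Lemma frac_le_total x : frac_le 0 x || frac_le x 0.
Proof. by rewrite frac_le0 /frac_le sub0r frac_ge0_or. Qed.

Lemma frac_normN x : frac_norm (- x) = frac_norm x.
Proof.
rewrite /frac_norm opprK; case: ifP; case: ifP => //; last first.
  by have := frac_ge0_or x => /orP[->|->].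
move=> h h'; apply: esym; suff -> : x = 0 by rewrite oppr0.
by apply: frac_le_anti; rewrite /frac_le ?subr0 ?sub0r.
Qed.

Lemma frac_ge0_norm x : frac_le 0 x -> frac_norm x = x.
Proof. by rewrite frac_le0 /frac_norm => ->. Qed.

HB.instance Definition _ := Num.IntegralDomain_isLeReal.Build frac
  frac_le_add frac_le_mul frac_le_anti frac_sub_ge0 frac_le_total
  frac_normN frac_ge0_norm (fun _ _ => erefl).

Definition inj a : frac := mkfrac (a, 0, 0).

Lemma injD a b : inj (a + b) = inj a + inj b.
Proof. by rewrite mkfracD; apply/mkfrac_eq/eqP => /=; ring. Qed.

Lemma injM a b : inj (a * b) = inj a * inj b.
Proof. by rewrite mkfracM; apply/mkfrac_eq/eqP => /=; ring. Qed.

Lemma inj0 : inj 0 = 0. Proof. by []. Qed.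
Lemma inj1 : inj 1 = 1. Proof. by []. Qed.

Lemma inj_lt a b : (inj a < inj b)%R <-> a ≺ b.
Proof.
rewrite ltNge; split=> [/negP h|h].
  case: (nl_total a b) => [//|e|ba]; case: h; first by rewrite e.
  rewrite -subr_ge0 [_ <= _]frac_le0 frac_oppE mkfracD; apply/mkfrac_ge0P => /=.
  by rewrite !(add0r, addr0, mulr1, mul0r); apply: nl_ltNge.
apply/negP; rewrite -subr_ge0 [_ <= _]frac_le0 frac_oppE mkfracD => /mkfrac_ge0P /=.
by rewrite !(add0r, addr0, mulr1, mul0r).
Qed.

Lemma inj_ge0 a : 0 <= inj a.
Proof. by rewrite leNgt -inj0; apply/negP => /inj_lt /nl_ge0. Qed.

Lemma inj_inj : injective inj.
Proof.
by move=> a b e; case: (nl_total a b) => // /inj_lt; rewrite e ltxx.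
Qed.

(** Archimedean relative to the given numbers, which may be nonstandard: a positive fraction is p /
    (d + 1) with p at least 1. *)
Lemma frac_archi (x : frac) : 0 < x -> exists d, 1 <= x * (inj d + 1).
Proof.
move=> x0; have /frac_ge0P[p [d ex]] : frac_ge0 x.
  by have := ltW x0; rewrite [_ <= _]frac_le0.
have e : x * (inj d + 1) = inj p.
  by rewrite ex -inj1 -injD mkfracM; apply/mkfrac_eq/eqP => /=; ring.
exists d; rewrite e.
have : 0 < inj p by rewrite -e; apply: mulr_gt0 => //; have := inj_ge0 d; lra.
rewrite -inj0 => /inj_lt/nl_sub[z ->]; rewrite !injD inj0 inj1.
by have := inj_ge0 z; lra.
Qed.

Lemma inj_ltS a b : inj a < inj b -> inj a + 1 <= inj b.
Proof.
by move/inj_lt/nl_sub=> [z ->]; rewrite !injD inj1; have := inj_ge0 z; lra.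
Qed.
End Fractions.

(** * Numbers of a model *)

Record rcaModel := RcaModel { rca_structure :> structure; rcaP : is_model rca_structure }.

Lemma eval_tsubst (M : structure) Γ Δ (s : sub Γ Δ) (ρ : env M Δ) τ (t : term Γ τ) :
  eval ρ (tsubst s t) = eval (fun τ v => eval ρ (s τ v)) t.
Proof. by elim: t => //= σ τ' t -> u ->. Qed.

Lemma econs_eta (M : structure) Γ σ (ρ : env M (σ :: Γ)) :
  ρ = econs (ρ σ VZ) (fun τ v => ρ τ (VS v)).
Proof.
apply: functional_extensionality_dep => τ; apply: funext; move: τ.
exact: var_ind_cons.
Qed.

Lemma sat_fsubst (M : structure) Γ Δ (s : sub Γ Δ) (ρ : env M Δ) (A : form Γ) :
  sat ρ (fsubst s A) <-> sat (fun τ v => eval ρ (s τ v)) A.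
Proof.
elim: A Δ s ρ => /= {Γ} [Γ t u|Γ t u|Γ|Γ A IA B IB|Γ σ A IA] Δ s ρ.
- by rewrite !eval_tsubst.
- by rewrite !eval_tsubst.
- by [].
- by rewrite IA IB.
- have e x : (fun τ v => eval (econs x ρ) (up s τ v)) =
             econs x (fun τ v => eval ρ (s τ v)) :> env M (σ :: Γ).
    rewrite [LHS]econs_eta; congr econs.
    by apply: functional_extensionality_dep => τ; apply: funext => v; apply: eval_tsubst.
  by split=> h x; have := h x; rewrite IA e.
Qed.

Lemma eval_wk_step (M : structure) Γ Δ σ (i : Incl Γ Δ) (ρ : env M Δ) (x : M σ) τ
    (t : term Γ τ) :
  eval (econs x ρ) (@wk _ _ (incl_step i) _ t) = eval ρ (@wk _ _ i _ t).
Proof. by rewrite /wk !eval_tsubst. Qed.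

Lemma wk_refl Γ τ (t : term Γ τ) : @wk _ _ incl_refl _ t = t.
Proof. exact: tsubst_id. Qed.

Lemma sat_not (M : structure) Γ (ρ : env M Γ) A : sat ρ (fNot A) <-> ~ sat ρ A.
Proof. by []. Qed.

Lemma sat_and (M : structure) Γ (ρ : env M Γ) A B :
  sat ρ (fAnd A B) <-> sat ρ A /\ sat ρ B.
Proof.
split=> [h|[a b] h]; last exact: (h a b).
by split; apply: contrapT => n; apply: h => a b; apply: n.
Qed.

Lemma sat_or (M : structure) Γ (ρ : env M Γ) A B :
  sat ρ (fOr A B) <-> sat ρ A \/ sat ρ B.
Proof.
split=> [h|[a|b]] //=; have [a|a] := pselect (sat ρ A); first by left.
by right; apply: h.
Qed.

Lemma sat_ex (M : structure) Γ (ρ : env M Γ) σ (b : term (σ :: Γ) σ -> form (σ :: Γ)) :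
  sat ρ (bEx σ b) <-> exists x : M σ, sat (econs x ρ) (b (Var VZ)).
Proof.
split=> [h|[x bx] h]; last exact: (h x bx).
by apply: contrapT => n; apply: h => x bx; apply: n; exists x.
Qed.

Lemma sat_all (M : structure) Γ (ρ : env M Γ) σ (b : term (σ :: Γ) σ -> form (σ :: Γ)) :
  sat ρ (bAll σ b) <-> forall x : M σ, sat (econs x ρ) (b (Var VZ)).
Proof. by []. Qed.

Lemma sat_eq (M : structure) Γ (ρ : env M Γ) t u :
  sat ρ (fEq t u) <-> eval ρ t = eval ρ u.
Proof. by []. Qed.

Lemma sat_lt (M : structure) Γ (ρ : env M Γ) t u :
  sat ρ (fLt t u) <-> mlt (eval ρ t) (eval ρ u).
Proof. by []. Qed.

Lemma sat_imp (M : structure) Γ (ρ : env M Γ) A B :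
  sat ρ (fImp A B) <-> (sat ρ A -> sat ρ B).
Proof. by []. Qed.

Lemma sat_eqT (M : structure) Γ (ρ : env M Γ) τ (t u : term Γ τ) :
  sat ρ (eqT τ t u) <-> eval ρ t = eval ρ u.
Proof.
elim: τ Γ ρ t u => [//|σ _ τ IH] Γ ρ t u; rewrite [eqT _ _ _]/= sat_all.
split=> [h|e x]; first apply: app_ext => x.
  by have := h x; rewrite IH /= !eval_wk_step !wk_refl.
by rewrite IH /= !eval_wk_step !wk_refl e.
Qed.

Lemma app_Pi (M : rcaModel) σ τ (x : M σ) (y : M τ) :
  app (app (cst M (cPi σ τ)) x) y = x.
Proof. exact: (proj1 (sat_eqT _ _ _) (rcaP (enil M) (ax_Pi σ τ) x y)). Qed.

Lemma app_Sigma (M : rcaModel) ρ σ τ (x : M (Arr ρ (Arr σ τ))) (y : M (Arr ρ σ)) (z : M ρ) :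
  app (app (app (cst M (cSigma ρ σ τ)) x) y) z = app (app x z) (app y z).
Proof. exact: (proj1 (sat_eqT _ _ _) (rcaP (enil M) (ax_Sigma ρ σ τ) x y z)). Qed.

Lemma eval_lam (M : rcaModel) Γ σ τ (t : term (σ :: Γ) τ) (ρ : env M Γ) (x : M σ) :
  app (eval ρ (lam t)) x = eval (econs x ρ) t.
Proof.
elim: t => [τ' v|τ' c|τ1 τ2 t IHt u IHu].
- move: τ' v; apply: var_ind_cons => [|τ' v] /=; last by rewrite app_Pi.
  by rewrite app_Sigma app_Pi.
- by rewrite /= app_Pi.
- by rewrite /= app_Sigma IHt IHu.
Qed.

Lemma eval_bLam (M : rcaModel) Γ σ τ (b : term (σ :: Γ) σ -> term (σ :: Γ) τ)
    (ρ : env M Γ) (x : M σ) :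
  app (eval ρ (bLam σ b)) x = eval (econs x ρ) (b (Var VZ)).
Proof. exact: eval_lam. Qed.

Lemma eval_app (M : structure) Γ (ρ : env M Γ) σ τ (t : term Γ (Arr σ τ)) (u : term Γ σ) :
  eval ρ (App t u) = app (eval ρ t) (eval ρ u).
Proof. by []. Qed.

Lemma eval_VZ (M : structure) Γ σ (ρ : env M Γ) (x : M σ) :
  eval (econs x ρ) (Var VZ) = x.
Proof. by []. Qed.

Lemma eval_VS (M : structure) Γ σ τ (ρ : env M Γ) (x : M σ) (v : var Γ τ) :
  eval (econs x ρ) (Var (VS v)) = eval ρ (Var v).
Proof. by []. Qed.

Section Numbers.
Variable M : rcaModel.

Definition num : Type := dom M T0.
HB.instance Definition _ := gen_eqMixin num.
HB.instance Definition _ := gen_choiceMixin num.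

Definition num_add (x y : num) : num := app (app (cst M cAdd) x) y.
Definition num_mul (x y : num) : num := app (app (cst M cMul) x) y.
Definition num0 : num := cst M cZero.
Definition num1 : num := cst M cOne.

Notation ax A := (rcaP (enil M) A).

Lemma num_addA : associative num_add.
Proof. by move=> x y z; apply: esym; exact: (ax ax_addA x y z). Qed.
Lemma num_addC : commutative num_add.
Proof. exact: (ax ax_addC). Qed.
Lemma num_add0 : left_id num0 num_add.
Proof. by move=> x; rewrite num_addC; exact: (ax ax_add0 x). Qed.
Lemma num_mulA : associative num_mul.
Proof. by move=> x y z; apply: esym; exact: (ax ax_mulA x y z). Qed.
Lemma num_mulC : commutative num_mul.
Proof. exact: (ax ax_mulC). Qed.
Lemma num_mul1 : left_id num1 num_mul.
Proof. by move=> x; rewrite num_mulC; exact: (ax ax_mul1 x). Qed.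
Lemma num_mul0 : left_zero num0 num_mul.
Proof. by move=> x; rewrite num_mulC; exact: (ax ax_mul0 x). Qed.
Lemma num_mulD : left_distributive num_mul num_add.
Proof. by move=> x y z; rewrite !(num_mulC _ z); exact: (ax ax_mulD z x y). Qed.
Lemma num_1neq0 : num1 != num0.
Proof.
apply/eqP => e; have := ax ax_lt01; rewrite /= -/num0 -/num1 e.
exact: (ax ax_lt_irr num0).
Qed.

HB.instance Definition _ := GRing.isNmodule.Build num num_addA num_addC num_add0.
HB.instance Definition _ := GRing.Nmodule_isComNzSemiRing.Build num
  num_mulA num_mulC num_mul1 num_mulD num_mul0 num_1neq0.

Local Open Scope ring_scope.
Definition num_lt (x y : num) := mlt x y.

Lemma eval_add Γ (ρ : env M Γ) t u :
  eval ρ (App (App (Cst cAdd) t) u) = (eval ρ t : num) + eval ρ u.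
Proof. by []. Qed.
Lemma eval_mul Γ (ρ : env M Γ) t u :
  eval ρ (App (App (Cst cMul) t) u) = (eval ρ t : num) * eval ρ u.
Proof. by []. Qed.
Lemma eval_0 Γ (ρ : env M Γ) : eval ρ (Cst cZero) = 0 :> num.
Proof. by []. Qed.
Lemma eval_1 Γ (ρ : env M Γ) : eval ρ (Cst cOne) = 1 :> num.
Proof. by []. Qed.
Definition evalE := (eval_VZ, eval_VS, eval_wk_step, wk_refl, eval_add, eval_mul,
  eval_0, eval_1).

Lemma num_irr (x : num) : ~ num_lt x x.
Proof. exact: (ax ax_lt_irr x). Qed.
Lemma num_trans (x y z : num) : num_lt x y -> num_lt y z -> num_lt x z.
Proof. exact: (ax ax_lt_trans x y z). Qed.
Lemma num_total (x y : num) : [\/ num_lt x y, x = y | num_lt y x].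
Proof.
have h := ax ax_lt_total; rewrite sat_all in h; have {}h := h x.
rewrite sat_all in h; have {h}/sat_or[h|/sat_or[h|h]] := h y;
  [constructor 1|constructor 2|constructor 3]; exact: h.
Qed.
Lemma num_ltD (x y z : num) : num_lt x y -> num_lt (x + z) (y + z).
Proof. exact: (ax ax_lt_add x y z). Qed.
Lemma num_ltM (x y z : num) : num_lt 0 z -> num_lt x y -> num_lt (x * z) (y * z).
Proof. exact: (ax ax_lt_mul x y z). Qed.
Lemma num_lt01 : num_lt 0 1.
Proof. exact: (ax ax_lt01). Qed.

Lemma form_ind Γ (ρ : env M Γ) (A : form (T0 :: Γ)) : quantifier_free A ->
  sat (econs (0 : num) ρ) A ->
  (forall n : num, sat (econs n ρ) A -> sat (econs (n + 1 : num) ρ) A) ->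
  forall n : num, sat (econs n ρ) A.
Proof.
move=> qA A0 AS; have := rcaP ρ (ax_ind A qA) => /=; apply.
  rewrite sat_fsubst; move: A0; rewrite [X in sat X A -> _]econs_eta.
  by rewrite [X in _ -> sat X A]econs_eta.
move=> n /AS; rewrite sat_fsubst [X in sat X A -> _]econs_eta.
by rewrite [X in _ -> sat X A]econs_eta.
Qed.

Lemma num_ltS (x : num) : num_lt x (x + 1).
Proof. by have := num_ltD x num_lt01; rewrite add0r addrC. Qed.

(** The ordered semiring axioms also hold in the integers, so that 0 is least has to come from
    induction. *)
Lemma num_ge0 (x : num) : ~ num_lt x 0.
Proof.
have h := @form_ind nil (enil M) (fNot (fLt (Var VZ) (Cst cZero))) (conj I I).
apply: (h _ _ x) => /= [|n nP lt]; first exact: num_irr.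
exact: nP (num_trans (num_ltS n) lt).
Qed.

Definition mrec (f : M (Arr T0 (Arr T0 T0))) (m n : num) : num :=
  app (app (app (cst M (cRec T0)) f) m) n.

Lemma mrec0 f m : mrec f m 0 = m.
Proof. exact: (ax ax_Rec_zero f m). Qed.
Lemma mrecS f m n : mrec f m (n + 1) = app (app f n) (mrec f m n).
Proof. exact: (ax ax_Rec_succ f m n). Qed.


Lemma eval_nrec Γ (ρ : env M Γ) s t u :
  eval ρ (nrec s t u) = mrec (eval ρ s) (eval ρ t) (eval ρ u).
Proof. by []. Qed.

(** An [nrec] evaluates its step term in the current environment. Extensionality identifies the
    result with a fixed element such as [e_pred], so that every recursion becomes one function on
    the model. *)
Lemma mrec_ext f g m n :
  (forall x y, app (app f x) y = app (app g x) y) -> mrec f m n = mrec g m n.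
Proof. by move=> h; congr (mrec _ _ _); do 2 apply: app_ext => ?; apply: h. Qed.

Definition e_pred : M (Arr T0 (Arr T0 T0)) :=
  eval (enil M) (λ[m : T0] λ[r : T0] ↑m)%tm.
Definition mpred (n : num) : num := mrec e_pred 0 n.

Lemma eval_npred Γ (ρ : env M Γ) (u : term Γ T0) :
  eval ρ (npred u) = mpred (eval ρ u).
Proof.
rewrite /npred eval_nrec; apply: mrec_ext => m r.
by rewrite !eval_bLam !evalE.
Qed.

Lemma mpred0 : mpred 0 = 0.
Proof. exact: mrec0. Qed.

Lemma mpredS n : mpred (n + 1) = n.
Proof. by rewrite /mpred mrecS /e_pred !eval_bLam !eval_wk_step wk_refl. Qed.

Lemma num_cases (n : num) : n = 0 \/ n = mpred n + 1.
Proof.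
pose A : form [:: T0] := (Var VZ ≐ 0 ∨ Var VZ ≐ npred (Var VZ) + 1)%fm.
have AE (k : num) : sat (econs k (enil M)) A <-> k = 0 \/ k = mpred k + 1.
  by rewrite /A sat_or !sat_eq !evalE eval_npred.
apply/AE; apply: form_ind => // [|k _]; apply/AE; first by left.
by right; rewrite mpredS.
Qed.

Definition e_sub : M (Arr T0 (Arr T0 T0)) :=
  eval (enil M) (λ[m : T0] λ[r : T0] npred r)%tm.
Definition msub (m n : num) : num := mrec e_sub m n.

Lemma eval_nsub Γ (ρ : env M Γ) (t u : term Γ T0) :
  eval ρ (nsub t u) = msub (eval ρ t) (eval ρ u).
Proof.
rewrite /nsub eval_nrec; apply: mrec_ext => m r.
by rewrite !eval_bLam !eval_npred.
Qed.

Lemma msub0 m : msub m 0 = m.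
Proof. exact: mrec0. Qed.

Lemma msubS m n : msub m (n + 1) = mpred (msub m n).
Proof. by rewrite /msub mrecS /e_sub !eval_bLam eval_npred. Qed.

(** Subtraction is either exact or cut off. This is the source of the differences in [num_sub],
    whose existence is not an axiom. *)
Lemma msub_cases (m n : num) :
  msub m n + n = m \/ msub m n = 0 /\ num_lt m n.
Proof.
pose a : term [:: T0; T0] T0 := Var (VS VZ).
pose A : form [:: T0; T0] :=
  ((nsub a (Var VZ) + Var VZ ≐ a) ∨ (nsub a (Var VZ) ≐ 0 ∧ a ≺ Var VZ))%fm.
have AE (k : num) : sat (econs k (econs m (enil M))) A <->
    msub m k + k = m \/ msub m k = 0 /\ num_lt m k.
  by rewrite /A sat_or sat_and sat_lt !sat_eq !evalE eval_nsub.
apply/AE; apply: form_ind => // [|k /AE h].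
  by apply/AE; left; rewrite msub0 addr0.
apply/AE; rewrite msubS; case: h => [e|[-> lt]]; last first.
  by right; rewrite mpred0; split=> //; apply: num_trans (num_ltS k).
have [e0|eS] := num_cases (msub m k).
  right; rewrite e0 mpred0; split=> //.
  by rewrite -e e0 add0r; apply: num_ltS.
by left; rewrite -[RHS]e [in RHS]eS addrA addrAC.
Qed.

Lemma num_sub (x y : num) : num_lt x y -> exists z, y = x + z + 1.
Proof.
move=> lt; have [e|[_ lt']] := msub_cases y x; last by case: (num_irr (num_trans lt lt')).
have [e0|eS] := num_cases (msub y x).
  by move: lt; rewrite -{}e e0 add0r => /num_irr.
by exists (mpred (msub y x)); rewrite -addrA -eS addrC.
Qed.

Lemma num_succ_gt0 (x : num) : num_lt 0 (x + 1).
Proof.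
by case: (num_total 0 (x + 1)) => // [e|/num_ge0//]; have := num_ltS x; rewrite -e => /num_ge0.
Qed.

Definition natlike_num : natlike :=
  @Natlike num num_lt num_irr num_trans num_total num_ltD num_ltM num_succ_gt0 num_sub.

Definition K := frac natlike_num.
HB.instance Definition _ := Num.RealField.on K.
Definition ι (x : num) : K := @inj natlike_num x.

Lemma ιD x y : ι (x + y) = ι x + ι y. Proof. exact: (@injD natlike_num). Qed.
Lemma ιM x y : ι (x * y) = ι x * ι y. Proof. exact: (@injM natlike_num). Qed.
Lemma ι0 : ι 0 = 0. Proof. exact: (@inj0 natlike_num). Qed.
Lemma ι1 : ι 1 = 1. Proof. exact: (@inj1 natlike_num). Qed.
Lemma ι_ge0 x : 0 <= ι x. Proof. exact: (@inj_ge0 natlike_num). Qed.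
Lemma ι_inj : injective ι. Proof. exact: (@inj_inj natlike_num). Qed.
Lemma ι_lt x y : num_lt x y <-> ι x < ι y.
Proof. by apply: iff_sym; exact: (@inj_lt natlike_num). Qed.
Lemma ι_ltS x y : ι x < ι y -> ι x + 1 <= ι y.
Proof. exact: (@inj_ltS natlike_num). Qed.
Lemma ι_pred n : n <> 0 -> ι n = ι (mpred n) + 1.
Proof. by move=> n0; case: (num_cases n) => [//|e]; rewrite {1}e ιD ι1. Qed.

Definition ιE := (ιD, ιM, ι0, ι1).

Lemma ι_sub m n : ι (msub m n) = if ι n <= ι m then ι m - ι n else 0.
Proof.
case: (msub_cases m n) => [e|[-> /ι_lt]]; last by rewrite ι0 ltNge; case: ifP.
have -> : ι m = ι (msub m n) + ι n by rewrite -ιD e.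
have h := ι_ge0 (msub m n); case: ifP => [_|/negbT]; first by lra.
by rewrite -ltNge => ?; lra.
Qed.
End Numbers.

(** * Quantifier-free induction *)

Section Induction.
Variable M : rcaModel.
Local Open Scope ring_scope.
Notation num := (num M).
Notation K := (K M).
Implicit Types (f g : num -> num) (P Q : num -> Prop).

Definition ndef f := exists d : M T1, forall n, app d n = f n.

Lemma ndef_id : ndef id.
Proof.
by exists (eval (enil M) (λ[n : T0] n)%tm) => n; rewrite eval_bLam.
Qed.

Lemma ndef_const (c : num) : ndef (fun=> c).
Proof.
by exists (app (cst M (cPi T0 T0)) c) => n; rewrite app_Pi.
Qed.

Lemma ndef_comp (d : M T1) f : ndef f -> ndef (fun n => app d (f n)).
Proof.
move=> [e fe]; pose d' : term [:: T1; T1] T1 := Var VZ.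
pose e' : term [:: T1; T1] T1 := Var (VS VZ).
exists (eval (econs d (econs e (enil M))) (λ[n : T0] ↑d' · (↑e' · n))%tm) => n.
by rewrite eval_bLam !eval_app !evalE -fe.
Qed.

Lemma ndef_app2 (d : M (Arr T0 (Arr T0 T0))) f g : ndef f -> ndef g ->
  ndef (fun n => app (app d (f n)) (g n)).
Proof.
move=> [e fe] [h gh]; pose d' : term [:: Arr T0 (Arr T0 T0); T1; T1] _ := Var VZ.
pose e' : term [:: Arr T0 (Arr T0 T0); T1; T1] T1 := Var (VS VZ).
pose h' : term [:: Arr T0 (Arr T0 T0); T1; T1] T1 := Var (VS (VS VZ)).
exists (eval (econs d (econs e (econs h (enil M))))
  (λ[n : T0] ↑d' · (↑e' · n) · (↑h' · n))%tm) => n.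
by rewrite eval_bLam !eval_app !evalE -fe -gh.
Qed.

Lemma ndef_add f g : ndef f -> ndef g -> ndef (fun n => f n + g n).
Proof. exact: ndef_app2. Qed.

Lemma ndef_mul f g : ndef f -> ndef g -> ndef (fun n => f n * g n).
Proof. exact: ndef_app2. Qed.

Lemma ndef_sub f g : ndef f -> ndef g -> ndef (fun n => msub (f n) (g n)).
Proof. exact: ndef_app2. Qed.

Lemma ndef_mrec e c f : ndef f -> ndef (fun n => mrec e c (f n)).
Proof. exact: ndef_comp. Qed.

(** The predicates of the metatheory to which the induction axiom applies: those with a
    characteristic function in the model, 0 standing for truth. That function serves as the
    parameter of the induction formula. *)
Definition qpred P := exists2 f, ndef f & forall n, P n <-> f n = 0.

Lemma num_ind P : qpred P -> P 0 -> (forall n, P n -> P (n + 1)) -> forall n, P n.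
Proof.
move=> [f [d df] Pf] P0 PS.
pose A : form [:: T0; T1] := (Var (VS VZ) · Var VZ ≐ 0)%fm.
have AE (k : num) : sat (econs k (econs d (enil M))) A <-> P k.
  by rewrite /A sat_eq eval_app !evalE Pf -df.
move=> n; apply/AE; apply: form_ind => // [|k /AE /PS Pk]; exact/AE.
Qed.

Lemma ι_eq0 (x : num) : x = 0 <-> ι x = 0.
Proof. by rewrite -(ι0 M); split=> [->|/ι_inj]. Qed.

Lemma qpred_le f g : ndef f -> ndef g -> qpred (fun n => ι (f n) <= ι (g n)).
Proof.
move=> df dg; exists (fun n => msub (f n) (g n)); first exact: ndef_sub.
move=> n; rewrite ι_eq0 ι_sub; case: ifP => [le|/negbT]; last by rewrite -ltNge => /ltW.
by split=> [h|h]; lra.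
Qed.

Lemma qpred_imp P Q : qpred P -> qpred Q -> qpred (fun n => P n -> Q n).
Proof.
(* As 0 is truth, the product vanishes iff the premise fails, that is [f n] is nonzero, or [g n] is
   0. *)
move=> [f df Pf] [g dg Qg]; exists (fun n => msub 1 (f n) * g n).
  by apply: ndef_mul => //; apply: ndef_sub => //; apply: ndef_const.
move=> n; rewrite Pf Qg !ι_eq0 ιM ι_sub ι1.
have [->|f0] := eqVneq (f n) 0.
  by rewrite ι0 ler01 subr0 mul1r; split=> [h|//]; exact: h.
have [] : 1 <= ι (f n) /\ ι (f n) <> 0.
  split; last by move=> /ι_eq0 e; move: f0; rewrite e eqxx.
  have := @ι_pred M (f n); have := ι_ge0 (mpred (f n)) => p /(_ _)e.
  by rewrite e; [lra|move/eqP: f0].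
by move=> f1 fn0; split=> // _; case: ifP => h;
  [have -> : ι (f n) = 1 by lra|]; rewrite ?subrr mul0r.
Qed.

(** A proposition without the induction variable is decided in the metatheory, whatever its
    complexity. *)
Lemma qpred_const (p : Prop) : qpred (fun=> p).
Proof.
have [hp|hp] := pselect p; [exists (fun=> 0)|exists (fun=> 1)]; try exact: ndef_const.
  by [].
by move=> n; split=> // /eqP; rewrite oner_eq0.
Qed.

Lemma qpred_not P : qpred P -> qpred (fun n => ~ P n).
Proof. by move=> qP; apply: qpred_imp => //; apply: qpred_const. Qed.

Lemma qpred_ext P Q : (forall n, P n <-> Q n) -> qpred P -> qpred Q.
Proof. by move=> PQ [f df Pf]; exists f => // n; rewrite -PQ. Qed.

Lemma qpred_and P Q : qpred P -> qpred Q -> qpred (fun n => P n /\ Q n).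
Proof.
move=> qP qQ; apply: (@qpred_ext (fun n => ~ (P n -> ~ Q n))).
  move=> n; split=> [h|[p q] h]; last exact: h.
  by split; apply: contrapT => h'; apply: h => p q; apply: h'.
by apply: qpred_not; apply: qpred_imp => //; apply: qpred_not.
Qed.

Lemma qpred_lt f g : ndef f -> ndef g -> qpred (fun n => ι (f n) < ι (g n)).
Proof.
move=> df dg; apply: (@qpred_ext (fun n => ~ (ι (g n) <= ι (f n)))).
  by move=> n; rewrite ltNge; split=> /negP.
by apply: qpred_not; apply: qpred_le.
Qed.

Lemma qpred_eq f g : ndef f -> ndef g -> qpred (fun n => f n = g n).
Proof.
move=> df dg; apply: (@qpred_ext (fun n => ι (f n) <= ι (g n) /\ ι (g n) <= ι (f n))).
  move=> n; split=> [[h1 h2]|->]; last by rewrite lexx.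
  by apply: ι_inj; apply/eqP; rewrite eq_le h1 h2.
by apply: qpred_and; apply: qpred_le.
Qed.

Lemma num_le_add (m n : num) : ι m <= ι n -> exists c, n = m + c.
Proof.
move=> h; exists (msub n m); apply: ι_inj; rewrite ιD ι_sub h; ring.
Qed.

Definition e_pow : M (Arr T0 (Arr T0 T0)) :=
  eval (enil M) (λ[m : T0] λ[r : T0] r + r)%tm.
Definition mpow2 (n : num) : num := mrec e_pow 1 n.

Lemma eval_npow2 Γ (ρ : env M Γ) (u : term Γ T0) :
  eval ρ (npow2 u) = mpow2 (eval ρ u).
Proof.
rewrite /npow2 eval_nrec; apply: mrec_ext => m r.
by rewrite !eval_bLam !evalE.
Qed.

Lemma mpow2_0 : mpow2 0 = 1.
Proof. exact: mrec0. Qed.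

Lemma mpow2_S n : mpow2 (n + 1) = mpow2 n + mpow2 n.
Proof. by rewrite /mpow2 mrecS /e_pow !eval_bLam !evalE. Qed.

Lemma mpow2_gt n : ι n + 1 <= ι (mpow2 n) :> K.
Proof.
move: n; apply: num_ind => [||n]; last first.
- by rewrite mpow2_S !ιE; have := ι_ge0 n; lra.
- by rewrite mpow2_0 !ιE; lra.
have d : ndef (fun n => n + 1) by apply: ndef_add (ndef_id) (ndef_const _).
apply: qpred_ext (qpred_le d (ndef_mrec e_pow 1 ndef_id)) => n.
by rewrite !ιE.
Qed.

Lemma mpow2_D m n : mpow2 (m + n) = mpow2 m * mpow2 n.
Proof.
move: n; apply: num_ind => [||n IH].
- apply: qpred_eq; last by apply: ndef_mul; [apply: ndef_const|apply: ndef_mrec ndef_id].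
  by apply: ndef_mrec; apply: ndef_add ndef_id; apply: ndef_const.
- by rewrite addr0 mpow2_0 mulr1.
- by rewrite addrA !mpow2_S IH mulrDr.
Qed.

Definition eps (n : num) : K := (ι (mpow2 n))^-1.

Lemma mpow2_gt0 n : 0 < ι (mpow2 n) :> K.
Proof. by have := mpow2_gt n; have := ι_ge0 n; lra. Qed.

Lemma eps_gt0 n : 0 < eps n.
Proof. by rewrite invr_gt0 mpow2_gt0. Qed.

Lemma eps_D m n : eps (m + n) = eps m * eps n.
Proof. by rewrite /eps mpow2_D ιM invfM. Qed.

Lemma eps_1 : eps 1 = 2^-1.
Proof. by rewrite /eps -[1]add0r mpow2_S mpow2_0 !ιE. Qed.

Lemma eps_S n : eps (n + 1) = eps n / 2.
Proof. by rewrite eps_D eps_1. Qed.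

Lemma eps_mul n : (ι n + 1) * eps n <= 1.
Proof. by rewrite ler_pdivrMr ?mpow2_gt0// mul1r mpow2_gt. Qed.

Lemma eps_le1 n : eps n <= 1.
Proof. by have := eps_mul n; have := eps_gt0 n; have := ι_ge0 n; nra. Qed.

Lemma eps_mono m n : ι m <= ι n -> eps n <= eps m.
Proof.
by move/num_le_add=> [c ->]; rewrite eps_D; have := eps_le1 c; have := eps_gt0 m; nra.
Qed.

Lemma eps_archi (x : K) : 0 < x -> exists n, eps n < x.
Proof.
move=> x0; have [d xd] := frac_archi x0; exists (d + 1).
have {xd} : 1 <= x * (ι d + 1) by [].
have := eps_mul (d + 1); rewrite !ιE; have := ι_ge0 d; have := eps_gt0 (d + 1).
move: (eps _) (ι d) => e i e0 i0 h1 h2.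
rewrite ltNge; apply/negP => xe; nra.
Qed.
End Induction.

(** * Codes of rationals *)

Lemma diff_div_add (R : fieldType) (a b d a' b' d' : R) : (d != 0 -> d' != 0 ->
  (a * d' + a' * d - (b * d' + b' * d)) / (d * d') = (a - b) / d + (a' - b') / d')%R.
Proof. by move=> d0 d'0; field; rewrite d0 d'0. Qed.

Lemma diff_div_mul (R : fieldType) (a b d a' b' d' : R) : (d != 0 -> d' != 0 ->
  (a * a' + b * b' - (a * b' + b * a')) / (d * d') = ((a - b) / d) * ((a' - b') / d'))%R.
Proof. by move=> d0 d'0; field; rewrite d0 d'0. Qed.

Section Rationals.
Variable M : rcaModel.
Local Open Scope ring_scope.
Notation num := (num M).
Notation K := (K M).

Definition e_tri : M (Arr T0 (Arr T0 T0)) :=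
  eval (enil M) (λ[m : T0] λ[r : T0] r + (↑m + 1))%tm.
Definition mtri (n : num) : num := mrec e_tri 0 n.

Lemma eval_ntri Γ (ρ : env M Γ) (u : term Γ T0) : eval ρ (ntri u) = mtri (eval ρ u).
Proof.
rewrite /ntri eval_nrec; apply: mrec_ext => m r.
by rewrite !eval_bLam !evalE.
Qed.

Lemma mtri0 : mtri 0 = 0. Proof. exact: mrec0. Qed.
Lemma mtriS n : mtri (n + 1) = mtri n + (n + 1).
Proof. by rewrite /mtri mrecS /e_tri !eval_bLam !evalE. Qed.

Lemma mtriE n : ι (mtri n) = ι n * (ι n + 1) / 2 :> K.
Proof.
suff h : mtri n + mtri n = n * (n + 1).
  by have := congr1 (@ι M) h; rewrite !ιE => ?; lra.
move: n; apply: num_ind => [||n h].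
- apply: qpred_eq; first by apply: ndef_add; apply: ndef_mrec; apply: ndef_id.
  by apply: ndef_mul; [|apply: ndef_add]; try apply: ndef_id; apply: ndef_const.
- by rewrite mtri0 addr0 mul0r.
- by apply: (@ι_inj M); have := congr1 (@ι M) h; rewrite !mtriS !ιE; lra.
Qed.

Definition e_root : M (Arr T0 (Arr T0 T0)) := eval (enil M)
  (λ[m : T0] λ[r : T0] r + (1 ∸ (ntri (r + 1) ∸ (↑m + 1))))%tm.
Definition mroot (n : num) : num := mrec e_root 0 n.

Lemma eval_ntroot Γ (ρ : env M Γ) (u : term Γ T0) :
  eval ρ (ntroot u) = mroot (eval ρ u).
Proof.
rewrite /ntroot eval_nrec; apply: mrec_ext => m r.
by rewrite !eval_bLam !(eval_nsub, eval_ntri, evalE).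
Qed.

Lemma mrootS n : mroot (n + 1) =
  mroot n + msub 1 (msub (mtri (mroot n + 1)) (n + 1)).
Proof.
by rewrite /mroot mrecS /e_root !eval_bLam !(eval_nsub, eval_ntri, evalE).
Qed.

(** The root r grows by one exactly when the triangular number of r + 1 is at most n + 1, for then
    the inner truncated difference is 0 and the outer one is 1. *)
Lemma mroot_bounds n : ι (mtri (mroot n)) <= ι n /\ ι n < ι (mtri (mroot n + 1)).
Proof.
move: n; apply: num_ind => [||n [lo hi]].
- have dr : ndef mroot by apply: ndef_mrec; apply: ndef_id.
  apply: qpred_and; [apply: qpred_le|apply: qpred_lt]; try exact: ndef_id.
    exact: ndef_mrec.
  by apply: ndef_mrec; apply: ndef_add => //; apply: ndef_const.
- by rewrite /mroot mrec0 add0r -[1]add0r mtriS mtri0 !ιE; lra.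
- have {hi} := ι_ltS hi; rewrite mrootS.
  set t := mtri (mroot n + 1) => hi.
  have r0 := ι_ge0 (mroot n).
  have [le|lt] := lerP (ι t) (ι (n + 1)).
    have e : ι (msub t (n + 1)) = 0 by rewrite ι_sub; case: ifP => // h; lra.
    have -> : msub 1 (msub t (n + 1)) = 1.
      by apply: (@ι_inj M); rewrite ι_sub e !ιE ler01 subr0.
    by rewrite -/t mtriS -/t; move: le; rewrite !ιE => le; split; lra.
  have e : 1 <= ι (msub t (n + 1)).
    by rewrite ι_sub (ltW lt); have := ι_ltS lt; lra.
  have -> : msub 1 (msub t (n + 1)) = 0.
    by apply: (@ι_inj M); rewrite ι_sub !ιE; case: ifP => // h; lra.
  by rewrite addr0 -/t; move: lt; rewrite !ιE => lt; split; lra.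
Qed.

Definition mpair (a b : num) : num := mtri (a + b) + b.
Definition msnd (u : num) : num := msub u (mtri (mroot u)).
Definition mfst (u : num) : num := msub (mroot u) (msnd u).

Lemma eval_npair Γ (ρ : env M Γ) t u : eval ρ (npair t u) = mpair (eval ρ t) (eval ρ u).
Proof. by rewrite /npair !evalE eval_ntri. Qed.
Lemma eval_nsnd Γ (ρ : env M Γ) u : eval ρ (nsnd u) = msnd (eval ρ u).
Proof. by rewrite /nsnd eval_nsub eval_ntri eval_ntroot. Qed.
Lemma eval_nfst Γ (ρ : env M Γ) u : eval ρ (nfst u) = mfst (eval ρ u).
Proof. by rewrite /nfst eval_nsub eval_ntroot eval_nsnd. Qed.

(** Since b is at most a + b, the code lies between the triangular numbers of a + b and of a + b +
    1, and [mroot_bounds] leaves no other root. *)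
Lemma mroot_pair a b : mroot (mpair a b) = a + b.
Proof.
have [lo hi] := mroot_bounds (mpair a b); set r := mroot _ in lo hi *.
apply: (@ι_inj M); apply/eqP; rewrite eq_le.
have a0 := ι_ge0 a; have b0 := ι_ge0 b; have r0 := ι_ge0 r.
rewrite mtriE in lo; rewrite mtriE /mpair !ιE mtriE !ιE in hi lo.
apply/andP; split; rewrite leNgt; apply/negP => /ι_ltS; rewrite !ιE => h.
  by move: (ι a) (ι b) (ι r) a0 b0 r0 lo hi h => x y z *; nra.
by move: (ι a) (ι b) (ι r) a0 b0 r0 lo hi h => x y z *; nra.
Qed.

Lemma msnd_pair a b : msnd (mpair a b) = b.
Proof.
rewrite /msnd mroot_pair; apply: (@ι_inj M); rewrite ι_sub !ιE.
by have := ι_ge0 b; case: ifP => [_ _|/negbT]; [|rewrite -ltNge => h1 h2]; lra.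
Qed.

Lemma mfst_pair a b : mfst (mpair a b) = a.
Proof.
rewrite /mfst msnd_pair mroot_pair; apply: (@ι_inj M); rewrite ι_sub !ιE.
by have := ι_ge0 a; case: ifP => [_ _|/negbT]; [|rewrite -ltNge => h1 h2]; lra.
Qed.

Definition mrat (a b d : num) : num := mpair (mpair a b) d.

Lemma eval_rat Γ (ρ : env M Γ) a b d :
  eval ρ (rat a b d) = mrat (eval ρ a) (eval ρ b) (eval ρ d).
Proof. by rewrite /rat !eval_npair. Qed.

Definition val (c : num) : K :=
  (ι (mfst (mfst c)) - ι (msnd (mfst c))) / (ι (msnd c) + 1).

Lemma val_rat a b d : val (mrat a b d) = (ι a - ι b) / (ι d + 1).
Proof. by rewrite /val /mrat !(msnd_pair, mfst_pair). Qed.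

Lemma ι1_gt0 d : 0 < ι d + 1 :> K.
Proof. by have := ι_ge0 d; lra. Qed.
Lemma ι1_neq0 d : ι d + 1 != 0 :> K.
Proof. by rewrite gt_eqF// ι1_gt0. Qed.

(** Every element of the field is named by an object of the model; this provides the constant reals
    used as meshes, tolerances and integrals. *)
Lemma val_surj (x : K) : exists c, val c = x.
Proof.
have [[[a b] d] ->] := fracP x; exists (mrat a b d).
rewrite val_rat; apply: (mulIf (ι1_neq0 d)); rewrite mulfVK ?ι1_neq0//.
rewrite -(ι1 M) -ιD.
have -> : mkfrac (a, b, d) * ι (d + 1) = ι a - ι b.
  rewrite /ι [LHS]mkfracM frac_oppE mkfracD; apply/mkfrac_eq/eqP => /=; ring.
by [].
Qed.

Lemma mlt_or_eq (A B : num) : (mlt A B \/ A = B) <-> ι A <= ι B.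
Proof.
rewrite le_eqVlt; split=> [[/ι_lt ->|->]|/orP[/eqP/ι_inj|/ι_lt]]; rewrite ?eqxx ?orbT//.
  by right.
by left.
Qed.

Lemma sat_qlt Γ (ρ : env M Γ) q r :
  sat ρ (qlt q r) <-> val (eval ρ q) < val (eval ρ r).
Proof.
rewrite /qlt sat_lt /qpos /qneg /qden -[mlt _ _]/(num_lt _ _) ι_lt !evalE.
rewrite !(eval_nfst, eval_nsnd) !ιE /val.
move: (eval ρ q) (eval ρ r) => c e.
rewrite ltr_pdivrMr ?ι1_gt0// mulrAC ltr_pdivlMr ?ι1_gt0//.
by split=> h; lra.
Qed.

Lemma sat_qle Γ (ρ : env M Γ) q r :
  sat ρ (qle q r) <-> val (eval ρ q) <= val (eval ρ r).
Proof.
rewrite /qle sat_or sat_lt sat_eq mlt_or_eq /qpos /qneg /qden !evalE.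
rewrite !(eval_nfst, eval_nsnd) !ιE /val.
move: (eval ρ q) (eval ρ r) => c e.
rewrite ler_pdivrMr ?ι1_gt0// mulrAC ler_pdivlMr ?ι1_gt0//.
by split=> h; lra.
Qed.

Lemma ι_mpred_mul (a b : num) : ι (mpred ((a + 1) * (b + 1))) + 1 = (ι a + 1) * (ι b + 1).
Proof.
rewrite -ι_pred ?ιE// => /(congr1 (@ι M)); rewrite !ιE.
by apply/eqP; rewrite mulf_neq0 ?ι1_neq0.
Qed.

Lemma val_qadd Γ (ρ : env M Γ) q r :
  val (eval ρ (qadd q r)) = val (eval ρ q) + val (eval ρ r).
Proof.
rewrite /qadd eval_rat val_rat eval_npred /qpos /qneg /qden !evalE.
rewrite !(eval_nfst, eval_nsnd) ι_mpred_mul !ιE /val.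
by rewrite diff_div_add// ι1_neq0.
Qed.

Lemma val_qopp Γ (ρ : env M Γ) q : val (eval ρ (qopp q)) = - val (eval ρ q).
Proof.
rewrite /qopp eval_rat val_rat /qpos /qneg !(eval_nfst, eval_nsnd) /val.
by rewrite -opprB mulNr.
Qed.

Lemma val_qmul Γ (ρ : env M Γ) q r :
  val (eval ρ (qmul q r)) = val (eval ρ q) * val (eval ρ r).
Proof.
rewrite /qmul eval_rat val_rat eval_npred /qpos /qneg /qden !evalE.
rewrite !(eval_nfst, eval_nsnd) ι_mpred_mul !ιE /val.
by rewrite diff_div_mul// ι1_neq0.
Qed.

Lemma ι_qanum Γ (ρ : env M Γ) q : ι (eval ρ (qanum q)) =
  `|ι (mfst (mfst (eval ρ q))) - ι (msnd (mfst (eval ρ q)))|.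
Proof.
rewrite /qanum /qpos /qneg !(eval_nfst, eval_nsnd, eval_nsub, evalE) ιD.
move: (mfst (mfst _)) (msnd (mfst _)) => x y; rewrite !ι_sub.
case: ler0P => h; case: ifP => [|/negbT]; rewrite -?ltNge => h1;
  case: ifP => [|/negbT]; rewrite -?ltNge => h2; lra.
Qed.

Lemma val_qabs Γ (ρ : env M Γ) q : val (eval ρ (qabs q)) = `|val (eval ρ q)|.
Proof.
rewrite /qabs eval_rat val_rat ι_qanum eval_nsnd evalE ι0 subr0 /val.
by rewrite normrM normfV [X in _ = _ / X]gtr0_norm// ι1_gt0.
Qed.

Lemma val_qdist Γ (ρ : env M Γ) q r :
  val (eval ρ (qdist q r)) = `|val (eval ρ q) - val (eval ρ r)|.
Proof. by rewrite /qdist val_qabs val_qadd val_qopp. Qed.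

Lemma ι_mpred_pow n : ι (mpred (mpow2 n)) + 1 = ι (mpow2 n) :> K.
Proof.
rewrite -ι_pred // => /(congr1 (@ι M)) e.
by have := mpow2_gt0 n; rewrite e ι0 ltxx.
Qed.

Lemma val_qexp Γ (ρ : env M Γ) n : val (eval ρ (qexp n)) = eps (eval ρ n).
Proof.
rewrite /qexp eval_rat val_rat eval_npred eval_npow2 !evalE !ιE ι_mpred_pow.
by rewrite subr0 mul1r.
Qed.

Lemma val_qexp' Γ (ρ : env M Γ) n : val (eval ρ (qexp' n)) = 2 * eps (eval ρ n).
Proof.
rewrite /qexp' eval_rat val_rat eval_npred eval_npow2 !evalE !ιE ι_mpred_pow.
by rewrite subr0.
Qed.
End Rationals.

(** * Reals and Riemann sums *)

Section Reals.
Variable M : rcaModel.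
Local Open Scope ring_scope.
Notation num := (num M).
Notation K := (K M).
Implicit Types (f g : num -> num) (u v : num -> K).

(** The field lives outside the model; a sequence in it can enter an induction only through codes
    computed by an object of type 1. *)
Definition kdef u := exists2 f, ndef f & forall n, val (f n) = u n.

Lemma kdef_val f : ndef f -> kdef (fun n => val (f n)).
Proof. by exists f. Qed.

Lemma kdef_ext u v : (forall n, u n = v n) -> kdef u -> kdef v.
Proof. by move=> uv [f df fu]; exists f => // n; rewrite -uv. Qed.

Lemma kdef_const (x : K) : kdef (fun=> x).
Proof. by have [c cx] := val_surj x; exists (fun=> c) => //; apply: ndef_const. Qed.

Definition e_qadd := eval (enil M) (λ[q : T0] λ[r : T0] qadd ↑q r)%tm.

Lemma kdef_add u v : kdef u -> kdef v -> kdef (fun n => u n + v n).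
Proof.
move=> [f df fu] [g dg gv].
apply: kdef_ext (kdef_val (ndef_app2 e_qadd df dg)) => n.
by rewrite !eval_bLam val_qadd !evalE fu gv.
Qed.

Definition e_qmul := eval (enil M) (λ[q : T0] λ[r : T0] qmul ↑q r)%tm.

Lemma kdef_mul u v : kdef u -> kdef v -> kdef (fun n => u n * v n).
Proof.
move=> [f df fu] [g dg gv].
apply: kdef_ext (kdef_val (ndef_app2 e_qmul df dg)) => n.
by rewrite !eval_bLam val_qmul !evalE fu gv.
Qed.

Lemma kdef_opp u : kdef u -> kdef (fun n => - u n).
Proof.
move=> du; apply: kdef_ext (kdef_mul (kdef_const (-1)) du) => n.
by rewrite mulN1r.
Qed.

Lemma kdef_sub u v : kdef u -> kdef v -> kdef (fun n => u n - v n).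
Proof. by move=> du dv; apply: kdef_add => //; apply: kdef_opp. Qed.

Definition e_rat := eval (enil M) (λ[q : T0] rat q 0 0)%tm.

Lemma kdef_ι f : ndef f -> kdef (fun n => ι (f n)).
Proof.
move=> df; apply: kdef_ext (kdef_val (ndef_comp e_rat df)) => n.
by rewrite !eval_bLam eval_rat val_rat !evalE ι0 subr0 add0r divr1.
Qed.

Definition e_qle1 := eval (enil M)
  (λ[q : T0] λ[r : T0] qpos ↑q * qden r + qneg r * qden ↑q)%tm.
Definition e_qle2 := eval (enil M)
  (λ[q : T0] λ[r : T0] qpos r * qden ↑q + qneg ↑q * qden r)%tm.

(** After cross multiplication, comparing coded rationals is comparing numbers. *)
Lemma qpred_kle u v : kdef u -> kdef v -> qpred (fun n => u n <= v n).
Proof.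
move=> [f df fu] [g dg gv].
apply: qpred_ext (qpred_le (ndef_app2 e_qle1 df dg) (ndef_app2 e_qle2 df dg)) => n.
rewrite -fu -gv !eval_bLam.
pose q : term [:: T0; T0] T0 := Var (VS VZ).
have := sat_qle (econs (g n) (econs (f n) (enil M))) q (Var VZ).
by rewrite /qle sat_or sat_lt sat_eq mlt_or_eq.
Qed.

Lemma num_ind_le (P : num -> Prop) (N : num) : qpred P -> P 0 ->
  (forall n, ι n < ι N -> P n -> P (n + 1)) -> forall n, ι n <= ι N -> P n.
Proof.
move=> qP P0 PS; apply: num_ind => [||n IH].
- by apply: qpred_imp => //; apply: qpred_le; [apply: ndef_id|apply: ndef_const].
- by [].
- rewrite ιD ι1 => h; have lt : ι n < ι N by lra.
  by apply: PS => //; apply: IH; apply: ltW.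
Qed.

Definition apx (x : M T1) (n : num) : K := val (app x n).

Definition is_real x := forall n i, `|apx x n - apx x (n + i)| < eps n.
Definition real_eq x y := forall n, `|apx x n - apx y n| <= 2 * eps n.
Definition real_lt x y := exists n, apx x n + 2 * eps n < apx y n.
Definition real_le x y := forall n, apx x n <= apx y n + 2 * eps n.

Lemma sat_isreal Γ (ρ : env M Γ) x : sat ρ (isreal x) <-> is_real (eval ρ x).
Proof.
split=> [h n i|h].
  have {}h := proj1 (sat_all _ _) (proj1 (sat_all _ _) h n) i.
  by move/sat_qlt: h; rewrite val_qdist val_qexp !(evalE, eval_app).
rewrite /isreal sat_all => n; rewrite sat_all => i.
by apply/sat_qlt; rewrite val_qdist val_qexp !(evalE, eval_app); apply: h.
Qed.

Lemma sat_req Γ (ρ : env M Γ) x y :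
  sat ρ (req x y) <-> real_eq (eval ρ x) (eval ρ y).
Proof.
split=> [h n|h].
  have {}h := proj1 (sat_all _ _) h n.
  by move/sat_qle: h; rewrite val_qdist val_qexp' !(evalE, eval_app).
rewrite /req sat_all => n.
by apply/sat_qle; rewrite val_qdist val_qexp' !(evalE, eval_app); apply: h.
Qed.

Lemma sat_rlt Γ (ρ : env M Γ) x y :
  sat ρ (rlt x y) <-> real_lt (eval ρ x) (eval ρ y).
Proof.
rewrite /rlt sat_ex; split=> -[n h]; exists n.
  by move/sat_qlt: h; rewrite val_qadd val_qexp' !(evalE, eval_app).
by apply/sat_qlt; rewrite val_qadd val_qexp' !(evalE, eval_app); apply: h.
Qed.

Lemma sat_rle Γ (ρ : env M Γ) x y :
  sat ρ (rle x y) <-> real_le (eval ρ x) (eval ρ y).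
Proof.
rewrite /rle sat_not sat_rlt; split=> [h n|h [n]].
  by rewrite leNgt; apply/negP => lt; apply: h; exists n.
by have := h n; lra.
Qed.

Lemma apx_rnat Γ (ρ : env M Γ) c n : apx (eval ρ (rnat c)) n = ι (eval ρ c).
Proof. by rewrite /apx eval_bLam eval_rat val_rat !evalE ι0 subr0 add0r divr1. Qed.

Lemma apx_radd Γ (ρ : env M Γ) x y n : apx (eval ρ (radd x y)) n =
  apx (eval ρ x) (n + 1) + apx (eval ρ y) (n + 1).
Proof. by rewrite /apx eval_bLam val_qadd !(evalE, eval_app). Qed.

Lemma apx_ropp Γ (ρ : env M Γ) x n : apx (eval ρ (ropp x)) n = - apx (eval ρ x) n.
Proof. by rewrite /apx eval_bLam val_qopp !(evalE, eval_app). Qed.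

Lemma apx_rsub Γ (ρ : env M Γ) x y n : apx (eval ρ (rsub x y)) n =
  apx (eval ρ x) (n + 1) - apx (eval ρ y) (n + 1).
Proof. by rewrite /rsub apx_radd apx_ropp. Qed.

Lemma apx_rabs Γ (ρ : env M Γ) x n : apx (eval ρ (rabs x)) n = `|apx (eval ρ x) n|.
Proof. by rewrite /apx eval_bLam val_qabs !(evalE, eval_app). Qed.

Lemma apx_rdist Γ (ρ : env M Γ) x y n : apx (eval ρ (rdist x y)) n =
  `|apx (eval ρ x) (n + 1) - apx (eval ρ y) (n + 1)|.
Proof. by rewrite apx_rabs apx_rsub. Qed.

Lemma apx_rmul Γ (ρ : env M Γ) x y n : exists b, apx (eval ρ (rmul x y)) n =
  apx (eval ρ x) (n + b) * apx (eval ρ y) (n + b).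
Proof.
rewrite /rmul /apx; move: (App _ _) => b; exists (eval ρ b).
by rewrite eval_bLam val_qmul !(evalE, eval_app).
Qed.

(* The length of the sum may be a nonstandard number, so the sum is only available
   as the value at [k] of a definable solution [S] of the recursion. *)
Lemma apx_rsum Γ (ρ : env M Γ) (k : term Γ T0) a (n : num) : exists S : num -> K,
  [/\ kdef S, S 0 = 0,
      forall i, S (i + 1) = S i + apx (app (eval ρ a) i) (n + (eval ρ k : num)) &
      apx (eval ρ (rsum k a)) n = S (eval ρ k)].
Proof.
rewrite /rsum /apx eval_bLam eval_nrec eval_rat !evalE.
set e := eval _ (bLam _ _).
have eE i s : val (app (app e i) s) =
    val s + val (app (app (eval ρ a) i) (n + (eval ρ k : num))).
  by rewrite /e !eval_bLam val_qadd !(evalE, eval_app).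
move: e eE => e eE.
exists (fun i => val (mrec e (mrat 0 0 0) i)); split=> //.
- by apply: kdef_val; apply: ndef_mrec; apply: ndef_id.
- by rewrite mrec0 val_rat ι0 subr0 mul0r.
- by move=> i; rewrite mrecS eE.
Qed.

(** The increments are read at an index beyond n + k, which keeps k rounding errors small in total.
    The index [m'] of the function value is left open: the functions integrated below have constant
    approximations. *)
Lemma apx_riemann_sum Γ (ρ : env M Γ) h (k : term Γ T0) x t (n : num) : exists S : num -> K,
  [/\ kdef S, S 0 = 0,
      forall i, exists m, [/\ ι (n + (eval ρ k : num) + 1) <= ι m &
        exists m', S (i + 1) = S i +
        apx (app (eval ρ h) (app (eval ρ t) i)) m' *
        (apx (app (eval ρ x) (i + 1)) m - apx (app (eval ρ x) i) m)] &
      apx (eval ρ (riemann_sum h k x t)) n = S (eval ρ k)].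
Proof.
rewrite /riemann_sum.
set a := bLam _ _; have [S [dS S0 SS ->]] := apx_rsum ρ k a n.
exists S; split=> // i; rewrite SS /a eval_bLam.
set y := rsub _ _; set z := App _ _.
have [b ->] := apx_rmul (econs i ρ) z y (n + (eval ρ k : num)).
exists (n + (eval ρ k : num) + b + 1); split.
  by rewrite !ιE; have := ι_ge0 b; lra.
exists (n + (eval ρ k : num) + b).
by rewrite /y apx_rsub /z !(evalE, eval_app).
Qed.

Definition real01 x :=
  [/\ is_real x, forall n, 0 <= apx x n + 2 * eps n & forall n, apx x n <= 1 + 2 * eps n].

Lemma sat_in01 Γ (ρ : env M Γ) x : sat ρ (in01 x) <-> real01 (eval ρ x).
Proof.
rewrite /in01 !sat_and sat_isreal !sat_rle /real_le.
split=> [[h1 [h2 h3]]|[h1 h2 h3]]; split=> //.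
- by move=> n; have := h2 n; rewrite apx_rnat evalE ι0.
- by move=> n; have := h3 n; rewrite apx_rnat evalE ι1.
- by split=> n; rewrite apx_rnat evalE ?ι0 ?ι1.
Qed.

Definition real_pos x := is_real x /\ exists n, 2 * eps n < apx x n.

Lemma sat_posreal Γ (ρ : env M Γ) x : sat ρ (posreal x) <-> real_pos (eval ρ x).
Proof.
rewrite /posreal sat_and sat_isreal sat_rlt /real_pos /real_lt.
suff e n : apx (eval ρ (rnat 0)) n = 0.
  by split=> -[h [n hn]]; split=> //; exists n; move: hn; rewrite e add0r.
by rewrite apx_rnat evalE ι0.
Qed.

Lemma real_pos_ge x : real_pos x -> exists n0, forall m, ι n0 <= ι m -> eps n0 < apx x m.
Proof.
move=> [rx [n0 h]]; exists n0 => m /num_le_add[c ->].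
by have := rx n0 c; rewrite ltr_norml => /andP[? ?]; lra.
Qed.
End Reals.

(** * Tagged partitions *)

Section Integrals.
Variable M : rcaModel.
Local Open Scope ring_scope.
Notation num := (num M).
Notation K := (K M).
Implicit Types (x t : M (Arr T0 T1)) (Y : M T2) (i j k m n p q : num).

Lemma is_real_dist (a : M T1) p q : is_real a ->
  `|apx a p - apx a q| < eps p + eps q.
Proof.
move=> ra; have := ra p q; have := ra q p; rewrite [q + p]addrC.
by rewrite !ltr_norml => /andP[? ?] /andP[? ?]; apply/andP; split; lra.
Qed.

(** The witness of a strict inequality sits at an unknown index; this moves the inequality to a
    prescribed one. *)
Lemma real_lt_apx (a b : M T1) p : is_real a -> is_real b -> real_lt a b ->
  apx a p <= apx b p + 2 * eps p.
Proof.
move=> ra rb [n ab]; have := is_real_dist p n ra; have := is_real_dist p n rb.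
by rewrite !ltr_norml => /andP[? ?] /andP[? ?]; lra.
Qed.

Definition partition k x t := [/\
  forall i, ι i <= ι k -> real01 (app x i),
  forall i, ι i < ι k -> real01 (app t i),
  forall p, `|apx (app x (0 : num)) p| <= 2 * eps p,
  forall p, `|apx (app x k) p - 1| <= 2 * eps p &
  forall i, ι i < ι k -> [/\ real_lt (app x i) (app x (i + 1 : num)),
    real_le (app x i) (app t i) & real_le (app t i) (app x (i + 1 : num))]].

Lemma sat_all_imp Γ (ρ : env M Γ) σ (A B : term (σ :: Γ) σ -> form (σ :: Γ)) (z : M σ) :
  sat ρ (bAll σ (fun y => fImp (A y) (B y))) ->
  sat (econs z ρ) (A (Var VZ)) -> sat (econs z ρ) (B (Var VZ)).
Proof. exact. Qed.

Lemma sat_tagged_partition Γ (ρ : env M Γ) (k : term Γ T0) (x t : term Γ (Arr T0 T1)) :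
  sat ρ (tagged_partition k x t) -> partition (eval ρ k) (eval ρ x) (eval ρ t).
Proof.
rewrite /tagged_partition !sat_and => -[h1 [h2 [h3 [h4 h5]]]].
have lt_k i : ι i < ι (eval ρ k : num) -> sat (econs i ρ) (Var VZ ≺ ↑k)%fm.
  by move=> /ι_lt lt; rewrite sat_lt !evalE.
split.
- move=> i le;   have /sat_in01 : sat (econs i ρ) (in01 (↑x · Var VZ)%tm).
    by apply: (sat_all_imp h1); rewrite sat_or sat_lt sat_eq mlt_or_eq !evalE.
  by rewrite eval_app !evalE.
- move=> i /lt_k lt; have /sat_in01 := sat_all_imp h2 lt.
  by rewrite eval_app !evalE.
- move=> p; move/sat_req: h3 => /(_ p).
  by rewrite eval_app apx_rnat !evalE ι0 subr0.
- move=> p; move/sat_req: h4 => /(_ p).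
  by rewrite eval_app apx_rnat !evalE ι1.
- move=> i /lt_k lt; have /sat_and[+ /sat_and[]] := sat_all_imp h5 lt.
  rewrite !sat_rle sat_rlt.
  by rewrite ![eval _ (App _ _)]eval_app !evalE.
Qed.

Lemma sat_mesh_lt Γ (ρ : env M Γ) (k : term Γ T0) (x : term Γ (Arr T0 T1)) (d : term Γ T1) :
  sat ρ (mesh_lt k x d) -> forall i, ι i < ι (eval ρ k : num) ->
  exists n, apx (app (eval ρ x) (i + 1 : num)) (n + 1) - apx (app (eval ρ x) i) (n + 1) +
    2 * eps n < apx (eval ρ d) n.
Proof.
rewrite /mesh_lt => h i /ι_lt lt.
have lt' : sat (econs i ρ) (Var VZ ≺ ↑k)%fm by rewrite sat_lt !evalE.
have /sat_rlt[n] := sat_all_imp h lt'.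
by rewrite apx_rsub ![eval _ (App _ _)]eval_app !evalE => hn; exists n.
Qed.

(** Monotonicity of the division points over c steps, at the fixed index p to keep the induction
    quantifier-free; each step costs [2 * eps p]. *)
Lemma partition_mono k x t p j : partition k x t -> forall c, ι (j + c) <= ι k ->
  apx (app x j) p <= apx (app x (j + c : num)) p + ι c * (2 * eps p).
Proof.
move=> [r01 _ _ _ P]; apply: num_ind => [||c IH].
- have dj : ndef (fun c => j + c) by apply: ndef_add; [apply: ndef_const|apply: ndef_id].
  apply: qpred_imp.
    by apply: qpred_le => //; apply: ndef_const.
  apply: qpred_kle; first exact: kdef_const.
  apply: kdef_add; first exact: (kdef_val (ndef_app2 x dj (ndef_const _))).
  by apply: kdef_mul; [exact: (kdef_ι (ndef_id M))|apply: kdef_const].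
- by rewrite addr0 ι0 mul0r addr0.
- rewrite addrA => le; have lt : ι (j + c) < ι k by move: le; rewrite !ιE; lra.
  have [xlt _ _] := P _ lt.
  have [r1 _ _] := r01 _ (ltW lt); have [r2 _ _] := r01 _ le.
  have := real_lt_apx p r1 r2 xlt; have := IH (ltW lt).
  by rewrite ιD ι1; lra.
Qed.

Definition inj01 Y := forall a b : M T1, real01 a -> real01 b ->
  app Y a = app Y b -> real_eq a b.

(** Between the two tags lies the whole interval from [x (i0 + 1)] to [x (i0 + 2)], of positive
    length, so the tags differ as reals and injectivity separates their values. *)
Lemma tag_gap k x t Y i0 i : partition k x t -> inj01 Y ->
  ι i0 + 2 <= ι i -> ι i < ι k -> app Y (app t i0) <> app Y (app t i).
Proof.
move=> part Yinj le ltk eY.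
have [r01 t01 _ _ P] := part.
have ltk0 : ι i0 < ι k by lra.
have tt := Yinj _ _ (t01 _ ltk0) (t01 _ ltk) eY.
have ltk1 : ι (i0 + 1) < ι k by rewrite !ιE; lra.
have [_ _ tx] := P _ ltk0; have [_ xt _] := P _ ltk.
have [[n xx] _ _] := P _ ltk1.
have le2 : ι (i0 + 1 + 1) <= ι i by rewrite !ιE; lra.
have [c ic] := num_le_add le2.
have r2 : is_real (app x (i0 + 1 + 1 : num)).
  by have [] := r01 (i0 + 1 + 1) _ => //; lra.
have r1 : is_real (app x (i0 + 1 : num)) by have [] := r01 _ (ltW ltk1).
(* The length seen at the witness n, less one [eps n] for moving each end point to a later index. *)
set γ := apx (app x (i0 + 1 + 1 : num)) n - apx (app x (i0 + 1 : num)) n - 2 * eps n.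
have γ0 : 0 < γ by rewrite /γ; lra.
have c0 := ι_ge0 c.
(* At the later index, three comparisons (the two tags with each other, and each with its division
   point) cost 2 [eps] each, and [partition_mono] costs [2 * ι c]. *)
have γc0 : 0 < γ / (6 + 2 * ι c) by apply: divr_gt0 => //; lra.
have [m] := eps_archi γc0; rewrite ltr_pdivlMr; last by lra.
move=> hm; have ep : eps (n + m) * (6 + 2 * ι c) < γ.
  apply: le_lt_trans hm; apply: ler_wpM2r; first by lra.
  by apply: eps_mono; rewrite ιD; have := ι_ge0 n; lra.
have mono := @partition_mono _ _ _ (n + m) (i0 + 1 + 1) part c.
rewrite -ic in mono; have {}mono := mono (ltW ltk).
have := r1 n m; have := r2 n m; have := tt (n + m).
have := tx (n + m); have := xt (n + m).
rewrite !ltr_norml !ler_norml => ? ? /andP[? ?] /andP[? ?] /andP[? ?].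
by move: ep; rewrite /γ => ep; lra.
Qed.

Lemma tag_near k x t Y i0 i : partition k x t -> inj01 Y ->
  ι i0 < ι k -> ι i < ι k -> app Y (app t i0) = app Y (app t i) ->
  ι i0 <= ι i + 1 /\ ι i <= ι i0 + 1.
Proof.
move=> part Yinj lt0 lt e.
by split; rewrite leNgt -(ι1 M) -ιD; apply/negP => /ι_ltS; rewrite !ιE => h;
  [have := tag_gap part Yinj _ lt0 (esym e)|have := tag_gap part Yinj _ lt e];
  apply; lra.
Qed.

(* [cnt y j m] is the number of [i < m] with [y i < j]. *)
Definition e_cnt (y : M T1) : M (Arr T0 (Arr T0 (Arr T0 T0))) :=
  eval (econs y (enil M))
    (λ[j : T0] λ[i : T0] λ[s : T0] s + (1 ∸ ((↑(Var (VZ : var [:: T1] T1)) · ↑i + 1) ∸ ↑j)))%tm.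
Definition cnt (y : M T1) j m : num := mrec (app (e_cnt y) j) 0 m.

Lemma cnt0 y j : cnt y j 0 = 0.
Proof. exact: mrec0. Qed.

Lemma ι_lt_ind (a b : num) : ι (msub 1 (msub (a + 1) b)) = if ι a < ι b then 1 else 0 :> K.
Proof.
have h := ι_sub (a + 1) b; have := ι_sub 1 (msub (a + 1) b).
move: (msub _ b) (msub 1 _) h => s r; rewrite !ιE.
have [/ι_ltS lt|ge] := ltrP (ι a) (ι b).
  case: ifP => h es; case: ifP => h' er; lra.
rewrite ifT; last by lra.
by move=> es; case: ifP => h' er; lra.
Qed.

Lemma app_e_cnt y (j i s : num) : app (app (app (e_cnt y) j) i) s =
  (s : num) + msub 1 (msub ((app y i : num) + 1) j).
Proof. by rewrite /e_cnt !eval_bLam evalE !eval_nsub !(evalE, eval_app). Qed.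

Lemma cntS y j m :
  ι (cnt y j (m + 1)) = ι (cnt y j m) + (if ι (app y m : num) < ι j then 1 else 0).
Proof. by rewrite /cnt mrecS app_e_cnt ιD ι_lt_ind. Qed.

Lemma ndef_cnt y j : ndef (cnt y j).
Proof. exact: (ndef_mrec _ _ (ndef_id M)). Qed.

(** [cnt_le] is an induction on the threshold, so the count must be definable in that argument as
    well. *)
Lemma ndef_cnt_l y k : ndef (fun j => cnt y j k).
Proof.
pose e : term [:: Arr T0 (Arr T0 (Arr T0 T0)); T0] _ := Var VZ.
pose k' : term [:: Arr T0 (Arr T0 (Arr T0 T0)); T0] T0 := Var (VS VZ).
exists (eval (econs (e_cnt y) (econs k (enil M))) (λ[j : T0] nrec (↑e · j) 0 ↑k')%tm) => j.
by rewrite eval_bLam eval_nrec eval_app !evalE.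
Qed.
End Integrals.

(** * Counting small tags and bounding Riemann sums *)

Section Sums.
Variable M : rcaModel.
Local Open Scope ring_scope.
Notation num := (num M).
Notation K := (K M).
Implicit Types (x t : M (Arr T0 T1)) (Y : M T2) (i j k m n p q : num).

(** Raising the threshold from j to j + 1 admits only indices of value j, and these lie within one
    of any single such index [i0]. *)
Lemma cnt_le y k : (forall i i0, ι i < ι k -> ι i0 < ι k -> app y i = app y i0 ->
    ι i0 <= ι i + 1 /\ ι i <= ι i0 + 1) ->
  forall j, ι (cnt y j k) <= 3 * ι j.
Proof.
move=> near; apply: num_ind => [||j IH].
- apply: qpred_kle; first by apply: kdef_ι; apply: ndef_cnt_l.
  by apply: kdef_mul; [apply: kdef_const|apply: (kdef_ι (ndef_id M))].
- rewrite ι0 mulr0; move: k {near}; apply: num_ind => [||m IH].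
  + by apply: qpred_kle; [apply: kdef_ι; apply: ndef_cnt|apply: kdef_const].
  + by rewrite cnt0 ι0.
  + by rewrite cntS ι0 ltNge ι_ge0 addr0.
suff : ι (cnt y (j + 1) k) <= ι (cnt y j k) + 3 by rewrite !ιE; lra.
have incr m : app y m <> j -> (ι (app y m : num) < ι (j + 1)) = (ι (app y m : num) < ι j).
  move=> ne; apply/idP/idP; last by rewrite !ιE; lra.
  move=> /ι_ltS; rewrite !ιE => h; rewrite lt_neqAle; apply/andP; split; last by lra.
  by apply/eqP => /ι_inj.
have [[i0 [lt0 y0]]|none] := pselect (exists i0, ι i0 < ι k /\ app y i0 = j); last first.
  suff h : forall m, ι m <= ι k -> ι (cnt y (j + 1) m) <= ι (cnt y j m).
    by have := h k (lexx _); lra.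
  apply: num_ind_le => [||m lt IHm].
  - by apply: qpred_kle; apply: kdef_ι; apply: ndef_cnt.
  - by rewrite !cnt0.
  - by rewrite !cntS incr; [lra|move=> e; apply: none; exists m].
pose ind a m : num := msub 1 (msub (a + 1) m).
have dind a : ndef (ind a).
  by do 2 (apply: ndef_sub; first exact: ndef_const); apply: ndef_id.
have dindS a : ndef (fun m => ind a (m + 1)).
  do 2 (apply: ndef_sub; first exact: ndef_const).
  by apply: ndef_add; [apply: ndef_id|apply: ndef_const].
have indP a m : ι a + 1 <= ι m /\ ι (ind a m) = 1 :> K \/ ι m <= ι a /\ ι (ind a m) = 0 :> K.
  by rewrite /ind ι_lt_ind; case: ltrP => [/ι_ltS|] h; [left|right].
(* The three terms tell whether i0 - 1, i0 and i0 + 1 are below m; the first is written as i0 < m +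
   1 to avoid the predecessor. *)
pose B m := ind i0 (m + 1) + ind i0 m + ind (i0 + 1) m.
suff h : forall m, ι m <= ι k -> ι (cnt y (j + 1) m) <= ι (cnt y j m + B m).
  have := h k (lexx _); rewrite /B !ιE.
  by case: (indP i0 (k + 1)); case: (indP i0 k); case: (indP (i0 + 1) k);
    move=> -[_ ->] [_ ->] [_ ->]; lra.
apply: num_ind_le => [||m lt].
- apply: qpred_kle; apply: kdef_ι; first exact: ndef_cnt.
  by apply: ndef_add; [apply: ndef_cnt|
    exact: (ndef_add (ndef_add (dindS i0) (dind i0)) (dind (i0 + 1)))].
- by rewrite !cnt0 ι0 ι_ge0.
- have cases : ι (B m) <= ι (B (m + 1)) /\
      (ι i0 <= ι m + 1 -> ι m <= ι i0 + 1 -> ι (B m) + 1 <= ι (B (m + 1))).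
    (* With this, the increment of [B] telescopes to [i0 < m + 2] - [i0 + 1 < m], which is 1 exactly
       for m within one of i0. *)
    have shift_ind : ι (ind (i0 + 1) (m + 1)) = ι (ind i0 m).
      by rewrite /ind !ι_lt_ind !ιE ltrD2r.
    rewrite /B !ιD shift_ind.
    case: (indP i0 (m + 1 + 1)) => -[+ ->]; case: (indP (i0 + 1) m) => -[+ ->];
      rewrite !ιE => a1 a2; split=> *; lra.
  move=> IHm; rewrite (ιD (cnt y j m)) in IHm; rewrite (ιD (cnt y j (m + 1))) !cntS.
  have [e|ne] := pselect (app y m = j); last by rewrite incr//; lra.
  have [n1 n2] := near m i0 lt lt0 (etrans e (esym y0)).
  rewrite e ltxx (_ : ι j < ι (j + 1)); last by rewrite !ιE; lra.
  by have := cases.2 n1 n2; lra.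
Qed.

(** Compared with the telescoping sum of the increments at index p, a tag with value above n
    contributes its increment up to [2 * eps p], and any other tag contributes 0, a loss of at most
    [h]. The count uses n + 1 because [cnt] is strict. *)
Lemma sum_estimate k n p x t Y (S : num -> K) (h : K) (y : M T1) :
  partition k x t -> (forall i, app y i = app Y (app t i)) -> kdef S -> S 0 = 0 ->
  (forall i, ι i < ι k -> exists2 m, ι p <= ι m & S (i + 1) = S i +
     (if ι n < ι (app Y (app t i) : num) then 1 else 0) *
     (apx (app x (i + 1 : num)) m - apx (app x i) m)) ->
  0 <= h ->
  (forall i, ι i < ι k -> apx (app x (i + 1 : num)) p - apx (app x i) p <= h) ->
  forall m, ι m <= ι k ->
    apx (app x m) p - apx (app x (0 : num)) p - ι (cnt y (n + 1) m) * h -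
      ι m * (2 * eps p) <= S m /\
    S m <= apx (app x m) p - apx (app x (0 : num)) p + ι m * (2 * eps p).
Proof.
move=> [r01 _ _ _ P] yE dS S0 SS h0 hx.
have dX : kdef (fun m => apx (app x m) p - apx (app x (0 : num)) p).
  apply: kdef_sub; last exact: kdef_const.
  exact: (kdef_val (ndef_app2 x (ndef_id M) (ndef_const p))).
have de : kdef (fun m => ι m * (2 * eps p)).
  by apply: kdef_mul; [apply: (kdef_ι (ndef_id M))|apply: kdef_const].
apply: num_ind_le => [||i lt [lo hi]].
- apply: qpred_and; apply: qpred_kle => //; last exact: kdef_add.
  apply: kdef_sub => //; apply: kdef_sub => //.
  by apply: kdef_mul; [apply: kdef_ι; apply: ndef_cnt|apply: kdef_const].
- by rewrite S0 cnt0 ι0 !mul0r subrr !subr0 addr0.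
have lei : ι (i + 1) <= ι k by rewrite ιD ι1; apply: ι_ltS.
have [r1 _ _] := r01 _ (ltW lt); have [r2 _ _] := r01 _ lei.
have [xlt _ _] := P _ lt; have xx := real_lt_apx p r1 r2 xlt.
have {}hx := hx _ lt; have e0 := eps_gt0 p.
rewrite cntS yE !ιD !ι1; have [m pm ->] := SS _ lt.
have [bad|good] := lerP (ι (app Y (app t i) : num)) (ι n).
  rewrite ifT; last by lra.
  by rewrite mul0r; split; lra.
rewrite ifF; last by apply/negP => h'; have := ι_ltS good; lra.
have [c mc] := num_le_add pm.
have := r1 p c; have := r2 p c; rewrite -mc !ltr_norml => /andP[? ?] /andP[? ?].
by rewrite mul1r; split; lra.
Qed.
End Sums.

(** * Integrals *)

Lemma mul_div_cancel (R : realFieldType) (u E : R) :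
  (0 < u -> u * (E / (12 * u)) = E / 12)%R.
Proof. by move=> u0; field; rewrite gt_eqF. Qed.

(** Used with u and w the values of [eps] at n and k; it settles the nonlinear products in advance,
    leaving linear arithmetic. *)
Lemma error_bounds (R : realFieldType) (E u w n k : R) : (0 < E -> 0 < u -> 0 < w ->
  u <= 1 -> w <= 1 -> 0 <= n -> 0 <= k -> (n + 1) * u <= 1 -> (k + 1) * w <= 1 ->
  [/\ E * u <= E, (k + 1) * (E * u * w) <= E, E * u * w <= E & (n + 1) * (E * u * w) <= E])%R.
Proof.
move=> E0 u0 w0 u1 w1 n0 k0 nu kw.
have Eu : (E * u <= E)%R by rewrite ler_piMr// ltW.
have Eu0 : (0 < E * u)%R by apply: mulr_gt0.
have Ew : (E * w <= E)%R by rewrite ler_piMr// ltW.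
have Ew0 : (0 < E * w)%R by apply: mulr_gt0.
split=> //.
- rewrite (_ : (k + 1) * (E * u * w) = (E * u) * ((k + 1) * w))%R; last by ring.
  by apply: le_trans Eu; rewrite ler_piMr// ltW.
- by apply: le_trans Eu; rewrite ler_piMr// ltW.
- rewrite (_ : (n + 1) * (E * u * w) = (E * w) * ((n + 1) * u))%R; last by ring.
  by apply: le_trans Ew; rewrite ler_piMr// ltW.
Qed.

Section Oscillation.
Variable M : rcaModel.
Local Open Scope ring_scope.
Notation num := (num M).
Notation K := (K M).
Implicit Types (Y : M T2) (i j k m n p q : num).

Lemma const_real (z : K) : exists d : M T1, forall n, apx d n = z.
Proof.
have [c cz] := val_surj z; exists (app (cst M (cPi T0 T0)) c) => n.
by rewrite /apx app_Pi.
Qed.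

Lemma is_real_const (d : M T1) (z : K) : (forall n, apx d n = z) -> is_real d.
Proof. by move=> dz n i; rewrite !dz subrr normr0 eps_gt0. Qed.

Lemma real_pos_const (z : K) : 0 < z ->
  exists2 d : M T1, real_pos d & forall n, apx d n = z.
Proof.
move=> z0; have [d dz] := const_real z; exists d => //; split; first exact: is_real_const dz.
have z20 : 0 < z / 2 by lra.
by have [n hn] := eps_archi z20; exists n; rewrite dz; lra.
Qed.

(** The Riemann sum enters as an arbitrary definable solution [S] of its recursion. The index q + 1
    is that of [rdist], and q + 1 + k + 1 is the resulting bound of [apx_riemann_sum]. *)
Lemma sat_is_integral Γ (ρ : env M Γ) (h : term Γ (Arr T1 T1)) (a : term Γ T1) :
  is_real (eval ρ a) ->
  (forall e : M T1, real_pos e -> exists2 d : M T1, real_pos d &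
    forall k (x t : M (Arr T0 T1)), partition k x t ->
    (forall i, ι i < ι k -> exists n,
      apx (app x (i + 1 : num)) (n + 1) - apx (app x i) (n + 1) + 2 * eps n < apx d n) ->
    exists q, forall S : num -> K, kdef S -> S 0 = 0 ->
      (forall i, exists m, [/\ ι (q + 1 + k + 1) <= ι m &
        exists m', S (i + 1) = S i + apx (app (eval ρ h) (app t i)) m' *
          (apx (app x (i + 1 : num)) m - apx (app x i) m)]) ->
      `|S k - apx (eval ρ a) (q + 1)| + 2 * eps q < apx e q) ->
  sat ρ (is_integral h a).
Proof.
move=> ra H; rewrite /is_integral sat_and sat_isreal; split=> //.
rewrite sat_all => e; rewrite sat_imp sat_posreal eval_VZ => pe.
have [d pd Hd] := H e pe.
rewrite sat_ex; exists d; rewrite sat_and sat_posreal; split=> //.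
rewrite sat_all => k; rewrite sat_all => x; rewrite sat_all => t.
rewrite sat_imp => /sat_tagged_partition part; rewrite sat_imp => /sat_mesh_lt mesh.
have [q Hq] := Hd k x t part mesh.
apply/sat_rlt; exists q; rewrite apx_rdist.
pose h' : term [:: Arr T0 T1, Arr T0 T1, T0, T1, T1 & Γ] (Arr T1 T1) :=
  @wk _ _ (incl_step (incl_step (incl_step (incl_step (incl_step incl_refl))))) _ h.
have [S [dS S0 SS ->]] := apx_riemann_sum
  (econs t (econs x (econs k (econs d (econs e ρ))))) h'
  (Var (VS (VS VZ))) (Var (VS VZ)) (Var VZ) (q + 1).
rewrite /h' !eval_wk_step !wk_refl in SS *; exact: Hq.
Qed.

Lemma integral_zero Γ (ρ : env M Γ) (h : term Γ (Arr T1 T1)) (a : term Γ T1) :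
  (forall (b : M T1) m, apx (app (eval ρ h) b) m = 0) -> (forall m, apx (eval ρ a) m = 0) ->
  sat ρ (is_integral h a).
Proof.
move=> h0 a0; apply: sat_is_integral; first exact: is_real_const a0.
(* Every Riemann sum is 0, so any positive mesh will do, and the index witnessing that [e] is
   positive serves as q. *)
move=> e pe; exists e => // k x t _ _; have [_ [q hq]] := pe.
exists q => S dS S0 SS; suff -> : S k = 0 by rewrite a0 subr0 normr0 add0r.
have S_le : forall m, S m <= 0 /\ 0 <= S m.
  apply: num_ind => [||m IH].
  - by apply: qpred_and; apply: qpred_kle => //; apply: kdef_const.
  - by rewrite S0.
  - by have [m' [_ [m2 ->]]] := SS m; rewrite h0 mul0r addr0.
by apply/eqP; rewrite eq_le; have [-> ->] := S_le k.
Qed.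

Definition tag_value Y (t : M (Arr T0 T1)) : M T1 :=
  eval (econs Y (econs t (enil M)))
    (λ[i : T0] ↑(Var (VZ : var [:: T2; Arr T0 T1] T2)) ·
               (↑(Var (VS VZ : var [:: T2; Arr T0 T1] (Arr T0 T1))) · i))%tm.

Lemma tag_value_app Y t i : app (tag_value Y t) i = app Y (app t i).
Proof. by rewrite eval_bLam !(evalE, eval_app). Qed.

Lemma integral_one Γ (ρ : env M Γ) (h : term Γ (Arr T1 T1)) (a : term Γ T1) Y n :
  inj01 Y ->
  (forall (b : M T1) m,
    apx (app (eval ρ h) b) m = if ι n < ι (app Y b : num) then 1 else 0) ->
  (forall m, apx (eval ρ a) m = 1) ->
  sat ρ (is_integral h a).
Proof.
move=> Yinj hY a1; apply: sat_is_integral; first exact: is_real_const a1.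
move=> e /real_pos_ge[n0 en0]; have n_ge0 := ι_ge0 n; have E0 := eps_gt0 n0.
set E := eps n0 in E0 en0.
(* With this mesh, the at most 3(n + 1) tags of value at most n lose at most E / 4. *)
have z0 : 0 < E / (12 * (ι n + 1)) by apply: divr_gt0 => //; lra.
have [d pd dz] := real_pos_const z0; exists d => // k x t part mesh.
set z := E / _ in z0 dz.
have zE : (ι n + 1) * z = E / 12 by rewrite /z mul_div_cancel//; lra.
(* The summand n absorbs the factor n + 1 of the count; the four units make [2 * eps q] at most E /
   8. *)
pose q := n0 + n + (1 + 1 + 1 + 1).
exists q => S dS S0 SS; rewrite a1.
have {en0} : E < apx e q by apply: en0; rewrite /q !ιE; lra.
set p := q + 1 + k + 1 in SS *.
have eq : eps q = E * eps n / 16 by rewrite /q !eps_D !eps_1 -/E; lra.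
have ep : eps p = E * eps n * eps k / 64 by rewrite /p /q !eps_D !eps_1 -/E; lra.
have [f0 f1 f3 f2] := error_bounds E0 (eps_gt0 n) (eps_gt0 k) (eps_le1 n) (eps_le1 k)
  n_ge0 (ι_ge0 k) (eps_mul n) (eps_mul k).
have {}f1 : (ι k + 1) * eps p <= E / 64 by rewrite ep; lra.
have {}f2 : (ι n + 1) * eps p <= E / 64 by rewrite ep; lra.
have {}f3 : eps p <= E / 64 by rewrite ep; lra.
have {f0 eq ep} q16 : eps q <= E / 16 by rewrite eq; lra.
have yE := tag_value_app Y t; set y := tag_value Y t in yE.
have p0 := eps_gt0 p; clearbody p.
have h0 : 0 <= z + 2 * eps p by lra.
have hx i : ι i < ι k -> apx (app x (i + 1 : num)) p - apx (app x i) p <= z + 2 * eps p.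
  move=> lt; have [m] := mesh i lt; rewrite dz.
  have [r01 _ _ _ _] := part.
  have [r1 _ _] := r01 _ (ltW lt); have [r2 _ _] : real01 (app x (i + 1 : num)).
    by apply: r01; rewrite ιD ι1; apply: ι_ltS.
  have := is_real_dist p (m + 1) r1; have := is_real_dist p (m + 1) r2.
  have := eps_gt0 m; rewrite eps_S.
  by rewrite !ltr_norml => ? /andP[? ?] /andP[? ?] ?; lra.
have step i : ι i < ι k -> exists2 m, ι p <= ι m & S (i + 1) = S i +
     (if ι n < ι (app Y (app t i) : num) then 1 else 0) *
     (apx (app x (i + 1 : num)) m - apx (app x i) m).
  by move=> _; have [m [pm [m' e']]] := SS i; exists m => //; rewrite e' hY.
have [lo hi] := sum_estimate part yE dS S0 step h0 hx (lexx (ι k)).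
have near i i0 : ι i < ι k -> ι i0 < ι k -> app y i = app y i0 ->
    ι i0 <= ι i + 1 /\ ι i <= ι i0 + 1.
  by rewrite !yE => lt lt0 e'; apply: (tag_near part Yinj lt0 lt); rewrite e'.
have := cnt_le near (n + 1); rewrite ιD ι1.
set C := ι (cnt _ _ _) in lo *; move=> Cle.
have Ch : C * (z + 2 * eps p) <= 3 * (ι n + 1) * (z + 2 * eps p) by apply: ler_wpM2r.
have [_ _ x0 x1 _] := part; have := x0 p; have := x1 p.
rewrite !ler_norml => /andP[? ?] /andP[? ?] ?.
(* In units of E / 64, the losses are 16 from the mesh, 6 from the term [2 * eps p] of [hx], and 4
   from the two end points and the k steps. Together with 8 for [2 * eps q] this stays below 64. *)
suff : `|S k - 1| <= E * 28 / 64 by lra.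
by rewrite ler_norml; apply/andP; split; lra.
Qed.
End Oscillation.

(** * The oscillating sequence *)

Section Counterexample.
Variable M : rcaModel.
Local Open Scope ring_scope.
Notation num := (num M).
Notation K := (K M).
Implicit Types (Y : M T2) (i j k m n p q : num).

Definition e_par : M (Arr T0 (Arr T0 T0)) :=
  eval (enil M) (λ[m : T0] λ[r : T0] 1 ∸ r)%tm.
Definition par n : num := mrec e_par 0 n.

Lemma par_cases n : (par n = 0 /\ par (n + 1) = 1) \/ (par n = 1 /\ par (n + 1) = 0).
Proof.
have parS m : par (m + 1) = msub 1 (par m).
  by rewrite /par mrecS /e_par !eval_bLam eval_nsub !evalE.
have par01 : forall m, par m <> 0 -> par m = 1.
  have dpar : ndef par by apply: ndef_mrec; apply: ndef_id.
  apply: num_ind => [||m].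
  - apply: qpred_imp; first apply: qpred_not; apply: qpred_eq => //; exact: ndef_const.
  - by rewrite /par mrec0.
  - rewrite parS; have [->|/eqP h /(_ h) ->] := eqVneq (par m) 0.
      by move=> _ _; apply: (@ι_inj M); rewrite ι_sub !ιE ler01 subr0.
    by move=> n0; case: n0; apply: (@ι_inj M); rewrite ι_sub !ιE lexx subrr.
rewrite parS; have [->|/eqP /par01 ->] := eqVneq (par n) 0; [left|right];
  by split=> //; apply: (@ι_inj M); rewrite ι_sub !ιE ?ler01 ?lexx ?subrr ?subr0.
Qed.

(** The factor [1 ∸ ((n + 1) ∸ Y x)] is the indicator of n < Y x. *)
Definition osc Y : M (Arr T0 (Arr T1 T1)) := eval (econs Y (econs e_par (enil M)))
  (λ[n : T0] λ[x : T1] rnat (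
     nrec ↑(Var (VS VZ : var [:: T2; Arr T0 (Arr T0 T0)] (Arr T0 (Arr T0 T0)))) 0 ↑n *
     (1 ∸ ((↑n + 1) ∸ ↑(Var (VZ : var [:: T2; Arr T0 (Arr T0 T0)] T2)) · x))))%tm.

Lemma apx_osc Y n b m : apx (app (app (osc Y) n) b) m =
  ι (par n) * (if ι n < ι (app Y b : num) then 1 else 0).
Proof.
rewrite /osc !eval_bLam apx_rnat evalE eval_nrec !eval_nsub ιM -ι_lt_ind.
by rewrite !(evalE, eval_app).
Qed.

Definition zero_fun : M (Arr T1 T1) := eval (enil M) (λ[x : T1] rnat 0)%tm.

Lemma apx_zero_fun b m : apx (app zero_fun b) m = 0.
Proof. by rewrite eval_bLam apx_rnat evalE ι0. Qed.

Lemma sat_fun01_real Γ (ρ : env M Γ) (h : term Γ (Arr T1 T1)) :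
  (forall b, real01 b -> is_real (app (eval ρ h) b)) ->
  (forall b c, real01 b -> real01 c -> real_eq b c ->
     real_eq (app (eval ρ h) b) (app (eval ρ h) c)) ->
  sat ρ (fun01_real h).
Proof.
move=> hr he; rewrite /fun01_real sat_and; split.
  rewrite sat_all => b; rewrite sat_imp sat_in01 sat_isreal => b01.
  by rewrite eval_app !evalE; apply: hr.
rewrite sat_all => b; rewrite sat_all => c.
rewrite sat_imp sat_in01 => b01; rewrite sat_imp sat_in01 => c01.
rewrite sat_imp !sat_req; move: b01 c01; rewrite !evalE => b01 c01 bc.
by rewrite ![eval _ (App _ _)]eval_app !evalE; apply: he.
Qed.

Let F' : term [:: Arr T0 (Arr T1 T1); Arr T1 T1] (Arr T0 (Arr T1 T1)) := Var VZ.
Let f' : term [:: Arr T0 (Arr T1 T1); Arr T1 T1] (Arr T1 T1) := Var (VS VZ).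

Lemma sat_bounded_convergence (concl : forall Γ, term Γ (Arr T0 (Arr T1 T1)) -> form Γ)
    (f : M (Arr T1 T1)) (F : M (Arr T0 (Arr T1 T1))) :
  let ρ := econs F (econs f (enil M)) in
  sat (enil M) (bounded_convergence concl) ->
  sat ρ (fun01_real f') ->
  sat ρ (∀[n : T0] fun01_real (↑F' · n))%fm ->
  sat ρ (integrable f') ->
  sat ρ (∀[n : T0] integrable (↑F' · n))%fm ->
  sat ρ (pointwise_limit F' f') ->
  sat ρ (uniformly_bounded F') ->
  sat ρ (concl _ F').
Proof. by move=> ρ h; exact: (h f F). Qed.

Variable Y : M T2.
Hypothesis Y01 : forall b c : M T1, real01 b -> real01 c -> real_eq b c ->
  app Y b = app Y c.
Hypothesis Yinj : inj01 Y.

Let ρ := econs (osc Y) (econs zero_fun (enil M)).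

Lemma osc_integral Γ (r : env M Γ) (h : term Γ (Arr T1 T1)) (a : term Γ T1) n :
  eval r h = app (osc Y) n -> (forall m, apx (eval r a) m = ι (par n)) ->
  sat r (is_integral h a).
Proof.
move=> hn an; have [[p _]|[p _]] := par_cases n.
  apply: integral_zero => [b m|m]; last by rewrite an p ι0.
  by rewrite hn apx_osc p ι0 mul0r.
apply: (@integral_one _ _ _ _ _ Y n Yinj) => [b m|m]; last by rewrite an p ι1.
by rewrite hn apx_osc p ι1 mul1r.
Qed.

Lemma osc_convergence (concl : forall Γ, term Γ (Arr T0 (Arr T1 T1)) -> form Γ) :
  sat (enil M) (bounded_convergence concl) -> sat ρ (concl _ F').
Proof.
move=> h; apply: (sat_bounded_convergence h); rewrite -/ρ.
- apply: sat_fun01_real => [b _|b c _ _ _]; first exact: (is_real_const (apx_zero_fun b)).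
  by move=> n; rewrite !apx_zero_fun subrr normr0; have := eps_gt0 n; lra.
- rewrite sat_all => n; apply: sat_fun01_real => [b _|b c b01 c01 bc].
    by rewrite eval_app !evalE; apply: is_real_const (apx_osc _ _ _).
  move=> m; rewrite ![eval _ (App _ _)]eval_app !evalE !apx_osc (Y01 b01 c01 bc).
  by rewrite subrr normr0; have := eps_gt0 m; lra.
- rewrite /integrable sat_ex; have [d dz] := const_real (0 : K); exists d.
  by apply: integral_zero => [b m|m]; rewrite !evalE ?dz//; apply: apx_zero_fun.
- rewrite sat_all => n; rewrite /integrable sat_ex.
  have [d dz] := const_real (ι (par n)); exists d.
  by apply: (osc_integral (n := n)) => //; rewrite !(evalE, eval_app).
- rewrite /pointwise_limit sat_all => b; rewrite sat_imp => _.
  rewrite sat_all => e; rewrite sat_imp sat_posreal eval_VZ => -[_ [q hq]].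
  (* From n = Y b on, the indicator at b is 0, so convergence at b needs no tolerance. *)
  rewrite sat_ex; exists (app Y b : num); rewrite sat_all => n.
  rewrite sat_imp sat_or sat_lt sat_eq mlt_or_eq !evalE => le.
  apply/sat_rlt; exists q; rewrite apx_rdist ![eval _ (App _ _)]eval_app !evalE.
  by rewrite apx_osc apx_zero_fun (ltNge (ι n)) le mulr0 subr0 normr0 add0r.
- rewrite /uniformly_bounded sat_ex; exists (0 : num).
  rewrite sat_all => n; rewrite sat_all => b; rewrite sat_imp => _.
  apply/sat_rle => m; rewrite apx_rabs apx_rnat ![eval _ (App _ _)]eval_app !evalE apx_osc ιD ι0 ι1.
  have := eps_gt0 m; have [[-> _]|[-> _]] := par_cases n; rewrite ?ι0 ?ι1.
    by rewrite mul0r normr0; lra.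
  by rewrite mul1r; case: ifP; rewrite ?normr0 ?normr1; lra.
Qed.

Lemma osc_diverges : ~ sat ρ (integrals_converge F').
Proof.
rewrite /integrals_converge sat_ex => -[l]; rewrite sat_and sat_isreal => -[rl h].
have z0 : (0 : K) < 4^-1 by lra.
have [e pe ez] := real_pos_const z0.
have {h} := proj1 (sat_all _ _) h e; rewrite sat_imp sat_posreal eval_VZ => /(_ pe).
rewrite sat_ex => -[N hN].
have close n : ι N <= ι n -> exists q, `|ι (par n) - apx l (q + 1)| + 2 * eps q < 4^-1.
  move=> le; have := proj1 (sat_all _ _) hN n.
  rewrite sat_imp sat_or sat_lt sat_eq mlt_or_eq !evalE => /(_ le) hn.
  have [a an] := const_real (ι (par n)).
  have := proj1 (sat_all _ _) hn a; rewrite sat_imp.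
  have int_a : sat (econs a (econs n (econs N (econs e (econs l ρ)))))
      (is_integral (@wk _ _
          (incl_step (incl_step (incl_step (incl_step (incl_step incl_refl))))) _ F'
        · Var (VS VZ))%tm (Var VZ)).
    by apply: (osc_integral (n := n)) => //; rewrite !(evalE, eval_app).
  move=> /(_ int_a)/sat_rlt[q]; rewrite apx_rdist !evalE an ez => hq.
  by exists q.
(* The integrals at N and N + 1 are 0 and 1 in some order, so they cannot both be within 1/4 of
   [l]. *)
have [q hq] := close N (lexx _).
have [q' hq'] : exists q, `|ι (par ((N : num) + 1)) - apx l (q + 1)| + 2 * eps q < 4^-1.
  by apply: close; rewrite !ιE; lra.
have := is_real_dist (q + 1) (q' + 1) rl; rewrite !eps_S.
have q0 := eps_gt0 q; have q'0 := eps_gt0 q'.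
have {hq} : `|ι (par N) - apx l (q + 1)| < 4^-1 - 2 * eps q by lra.
have {hq'} : `|ι (par ((N : num) + 1)) - apx l (q' + 1)| < 4^-1 - 2 * eps q' by lra.
by have [[-> ->]|[-> ->]] := par_cases N; rewrite !ιE !ltr_norml;
  move=> /andP[? ?] /andP[? ?] /andP[? ?]; lra.
Qed.

Definition e_succ : M T1 := eval (enil M) (λ[n : T0] n + 1)%tm.

Lemma osc_not_metastable : ~ sat ρ (integrals_metastable F').
Proof.
rewrite /integrals_metastable => h.
have z0 : (0 : K) < 4^-1 by lra.
have [e pe ez] := real_pos_const z0.
have {h} := proj1 (sat_all _ _) h e; rewrite sat_imp sat_posreal eval_VZ => /(_ pe) h.
(* For g the successor, the interval from N to g(N) contains two numbers of opposite parity. *)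
have {h} := proj1 (sat_all _ _) h e_succ; rewrite sat_ex => -[N hN].
have succE : app e_succ N = (N : num) + 1 by rewrite eval_bLam !evalE.
have leS : ι (N : num) <= ι ((N : num) + 1) by rewrite !ιE; lra.
have {hN} := proj1 (sat_all _ _) (proj1 (sat_all _ _) hN N) ((N : num) + 1).
rewrite sat_imp sat_or sat_lt sat_eq mlt_or_eq !evalE => /(_ (lexx _)).
rewrite sat_imp sat_or sat_lt sat_eq mlt_or_eq eval_app !evalE succE => /(_ leS).
rewrite sat_imp sat_or sat_lt sat_eq mlt_or_eq !evalE => /(_ leS).
rewrite sat_imp sat_or sat_lt sat_eq mlt_or_eq eval_app !evalE succE => /(_ (lexx _)) h.
have [a an] := const_real (ι (par N)).
have [b bn] := const_real (ι (par ((N : num) + 1))).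
have {h} := proj1 (sat_all _ _) (proj1 (sat_all _ _) h a) b.
pose r := econs b (econs a (econs ((N : num) + 1) (econs N (econs N
  (econs e_succ (econs e ρ)))))).
pose F7 : term [:: T1, T1, T0, T0, T0, T1, T1 & [:: Arr T0 (Arr T1 T1); Arr T1 T1]]
  (Arr T0 (Arr T1 T1)) := @wk _ _ (incl_step (incl_step (incl_step (incl_step (incl_step (incl_step
  (incl_step incl_refl)))))))  _ F'.
have int_a : sat r (is_integral (F7 · Var (VS (VS (VS VZ))))%tm (Var (VS VZ))).
  by apply: (osc_integral (n := N)) => //; rewrite /r /F7 !(evalE, eval_app).
have int_b : sat r (is_integral (F7 · Var (VS (VS VZ)))%tm (Var VZ)).
  by apply: (osc_integral (n := (N : num) + 1)) => //; rewrite /r /F7 !(evalE, eval_app).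
rewrite sat_imp => /(_ int_a); rewrite sat_imp => /(_ int_b) /sat_rlt[q].
rewrite apx_rdist !evalE an bn ez; have := eps_gt0 q.
by case: (par_cases N) => -[-> ->]; rewrite !ιE ?subr0 ?sub0r ?normrN normr1; lra.
Qed.

End Counterexample.

(** * Deriving [NIN] *)

Lemma NIN_of_oscillation (M : rcaModel) :
  (forall Y : M T2, (forall b c : M T1, real01 b -> real01 c -> real_eq b c ->
     app Y b = app Y c) -> inj01 Y -> False) ->
  sat (enil M) NIN.
Proof.
move=> h; rewrite /NIN sat_all => Y; rewrite sat_imp /fun01_nat => Y01.
apply: contrapT => nN; apply: (h Y) => [b c b01 c01 bc|b c b01 c01 Ybc].
  have := proj1 (sat_all _ _) (proj1 (sat_all _ _) Y01 b) c.
  rewrite sat_imp sat_in01 => /(_ b01); rewrite sat_imp sat_in01 => /(_ c01).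
  by rewrite sat_imp sat_req sat_eq ![eval _ (App _ _)]eval_app !evalE => /(_ bc).
apply: contrapT => nbc; apply: nN; rewrite sat_ex; exists b; rewrite sat_ex; exists c.
rewrite sat_and sat_in01 sat_and sat_in01 sat_and sat_not sat_req sat_eq.
rewrite ![eval _ (App _ _)]eval_app !evalE.
by split=> //; split=> //; split.
Qed.

Theorem corollary3p7 :
  RCA0w_proves (Arz_limit ⟶ NIN) /\ RCA0w_proves (Arz_minus ⟶ NIN).
Proof.
split; apply: completeness => M0 axM; pose M := RcaModel axM;
  rewrite sat_imp => h; apply: (@NIN_of_oscillation M) => Y Y01 Yinj.
  exact: (osc_diverges Yinj (@osc_convergence M Y Y01 Yinj _ h)).
exact: (osc_not_metastable Yinj (@osc_convergence M Y Y01 Yinj _ h)).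
Qed.
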